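(* If $A$ and $B$ are discrete groups that are weakly amenable with Cowling–Haagerup constant $1$, then the free product $A\ast B$ is weakly amenable with Cowling–Haagerup constant $1$.
   Context: A function $\varphi:G\to\mathbb{C}$ on a discrete group is completely bounded if the associated multiplication operator $\sum a_g g\mapsto\sum a_g\varphi(g)g$ is a completely bounded map on $C^*_r(G)$; $\|\varphi\|_{cb}$ denotes its cb-norm. $G$ is weakly amenable with Cowling–Haagerup constant $1$ if there is a net $(\varphi_n)$ of finitely supported completely bounded functions on $G$ with $\varphi_n\to1$ pointwise and $\limsup_n\|\varphi_n\|_{cb}\le1$. *)

(* Defs.v *)
From HB Require Import structures.
From mathcomp Require Import all_boot all_order all_algebra.
From mathcomp Require Import monoid.
From mathcomp Require Import complex.
From mathcomp Require Import reals Rstruct.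
From Stdlib Require Import Rdefinitions.

Set Implicit Arguments.
Unset Strict Implicit.
Unset Printing Implicit Defensive.

Import Order.TTheory GRing.Theory Num.Theory.
Local Open Scope ring_scope.

Notation RR := Rdefinitions.R.
Notation CC := (RR[i]).

Definition modsq (z : CC) : RR := let: Complex a b := z in a ^+ 2 + b ^+ 2.

Section Discrete.
Variable G : groupType.


Definition supported_on (s : seq G) (f : G -> CC) : Prop :=
  uniq s /\ forall g, g \notin s -> f g = 0.

Definition finitely_supported (f : G -> CC) : Prop :=
  exists s : seq G, supported_on s f.

(* n x n matrices over the group algebra C[G] : entries X i j : G -> CC with
   common support [s] (sum_g X i j g * g). Vectors of l^2(G)^n : 'I_n -> G -> CC.
   Action of X on l^2(G)^n through the left regular representation
   lambda(g) delta_k = delta_{g k}: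
     (X xi)_i (h) = sum_j sum_{g in s} X i j g * xi j (g^-1 h). *)
Definition mat_apply n (s : seq G) (X : 'I_n -> 'I_n -> G -> CC)
    (xi : 'I_n -> G -> CC) : 'I_n -> G -> CC :=
  fun i h => \sum_(j < n) \sum_(g <- s)
      X i j g * xi j (monoid.mul (@monoid.inv G g) h).

Definition l2sq_on n (t : seq G) (xi : 'I_n -> G -> CC) : RR :=
  \sum_(i < n) \sum_(h <- t) modsq (xi i h).

(* ||X||_{B(l^2(G)^n)} <= M : for every finitely supported xi (these are
   dense in l^2(G)^n), ||X xi||^2 <= M^2 ||xi||^2, where ||X xi||^2 is the
   supremum of its finite partial sums (l^2 norm over an arbitrary index set). *)
Definition op_norm_le n (s : seq G) (X : 'I_n -> 'I_n -> G -> CC) (M : RR)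
    : Prop :=
  forall (xi : 'I_n -> G -> CC) (u : seq G),
    (forall j, supported_on u (xi j)) ->
    forall t : seq G, uniq t ->
      l2sq_on t (mat_apply s X xi) <= M ^+ 2 * l2sq_on u xi.

Definition mult_mat n (phi : G -> CC) (X : 'I_n -> 'I_n -> G -> CC)
    : 'I_n -> 'I_n -> G -> CC :=
  fun i j g => phi g * X i j g.

(* ||phi||_cb <= C : the multiplication operator M_phi on C*_r(G) is
   completely bounded with cb-norm at most C, i.e. for every n,
   ||(id_{M_n} (x) M_phi)(X)|| <= C ||X|| for all X in M_n(C[G])
   (M_n(C[G]) is dense in M_n(C*_r(G)), and C*_r(G) carries the operator
   norm from l^2(G)). *)
Definition cb_norm_le (phi : G -> CC) (C : RR) : Prop :=
  forall (n : nat) (s : seq G) (X : 'I_n -> 'I_n -> G -> CC) (M : RR),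
    (forall i j, supported_on s (X i j)) -> 0 <= M ->
    op_norm_le s X M -> op_norm_le s (mult_mat phi X) (C * M).

Definition completely_bounded (phi : G -> CC) : Prop :=
  exists C : RR, cb_norm_le phi C.

Definition weakly_amenable_CH1 : Prop :=
  exists (I : Type) (le : I -> I -> Prop) (phi : I -> G -> CC),
    (exists i : I, True) /\
    (forall i, le i i) /\
    (forall i j k, le i j -> le j k -> le i k) /\
    (forall i j, exists k, le i k /\ le j k) /\
    (forall i, finitely_supported (phi i) /\ completely_bounded (phi i)) /\
    (forall (g : G) (eps : RR), 0 < eps ->
       exists i0, forall i, le i0 i -> modsq (phi i g - 1) < eps ^+ 2) /\
    (forall eps : RR, 0 < eps ->
       exists i0, forall i, le i0 i -> cb_norm_le (phi i) (1 + eps)).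

End Discrete.

Definition group_hom (G H : groupType) (f : G -> H) : Prop :=
  forall x y : G, f (monoid.mul x y) = monoid.mul (f x) (f y).

Definition is_free_product (A B P : groupType) (iA : A -> P) (iB : B -> P)
    : Prop :=
  [/\ group_hom iA, group_hom iB &
      forall (H : groupType) (f : A -> H) (g : B -> H),
        group_hom f -> group_hom g ->
        exists h : P -> H,
          [/\ group_hom h, (forall a, h (iA a) = f a),
              (forall b, h (iB b) = g b) &
              forall h' : P -> H, group_hom h' ->
                (forall a, h' (iA a) = f a) -> (forall b, h' (iB b) = g b) ->
                forall x, h' x = h x]].

(* Main.v *)
From HB Require Import structures.
Require Import Defs.
From mathcomp Require Import all_boot all_order all_algebra monoid.
From mathcomp Require Import complex reals Rstruct.
From mathcomp Require Import boolp classical_sets.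
From mathcomp Require Import ring lra zify.

(** A finitely supported multiplier of norm at most [1 + e] with value 1 at the identity has, by
    duality, a kernel [phi (x^-1 y)] that factors through Hilbert space vectors [xi x, eta y] of
    norm close to 1; since [<xi x, eta x> = 1], [xi] and [eta] are close to each other, so that the
    kernel [v] is close to the positive definite kernel [u (x, y) = <xi x, xi y>], normalized to 1
    on the diagonal.  A pair of such kernels on [A] and [B] induces a kernel on words, a product
    over the cosets separating two words in the Bass-Serre tree.  For the damped kernels
    [r u + (1 - r) delta] this product is contractive.  On pairs of words at a fixed distance the
    kernel is a finite sum of products of pulled back kernels, one for each position of the longest
    common prefix.  Hence cutting off at distance [2 m] costs at most a geometric tail, and
    replacing [u] by [v] below the cut-off costs a constant (depending on [r] and [m] only) times
    the distance from [u] to [v].  The result is the kernel of the multiplier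
    [z |-> r ^ |z| phi (z_1) ... phi (z_n)], truncated at length [2 m].  This is the strategy of
    Ricard and Xu, carried out with Schur multipliers. *)

Set Implicit Arguments.
Unset Strict Implicit.
Unset Printing Implicit Defensive.
Import Order.TTheory GRing.Theory Num.Theory.
Local Open Scope ring_scope.
Local Open Scope complex_scope.
Local Notation Rp := (@complex.Re _).
Local Notation Ip := (@complex.Im _).
Local Notation toC r := (Complex r 0).
Local Notation mulg := monoid.mul.
Local Notation invg := monoid.inv.

(** * Schur multiplier kernels *)

Section Modulus.
Variable R : realType.
Local Notation CC := R[i].

(** A product over arbitrarily many cosets multiplies norms: a bound 1 + e on letters becomes (1 +
    e)^n on words of length n. Only the exact bound 1 survives, together with the value 1 on the
    diagonal, which makes the cosets that do not separate two words invisible. Hence the almost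
    contractive kernel v is traded for the exactly contractive u. But u need not come from a
    function on the group, so v has to return below the cut-off, where words are short and powers of
    norms stay bounded. Damping with delta keeps both the bound and the diagonal and supplies the
    decay r ^ n that makes the tail summable. The constants are fixed in the order r, m, and only
    then the quality of the multipliers of A and B.

    No infinite-dimensional Hilbert space and no compactness enter: a Schur bound tests finite
    families of points, so a kernel may be replaced by a different one for each finite set, and
    duality takes place in a finite-dimensional real space. *)

Definition sqmod (z : CC) : R := let: Complex a b := z in a ^+ 2 + b ^+ 2.

Lemma sqmodE (z : CC) : sqmod z = Rp z ^+ 2 + Ip z ^+ 2.
Proof. by case: z. Qed.

Lemma sqmod_ge0 (z : CC) : 0 <= sqmod z.
Proof. by rewrite sqmodE addr_ge0 ?sqr_ge0. Qed.

Lemma sqmodM (z w : CC) : sqmod (z * w) = sqmod z * sqmod w.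
Proof. by case: z => a b; case: w => c d; rewrite /sqmod /=; ring. Qed.

Lemma sqmodN (z : CC) : sqmod (- z) = sqmod z.
Proof. by case: z => a b; rewrite /sqmod /= !sqrrN. Qed.

Lemma sqmod_conj (z : CC) : sqmod (z^*)%C = sqmod z.
Proof. by case: z => a b; rewrite /sqmod /= sqrrN. Qed.

Lemma sqmod_toC (r : R) : sqmod (toC r) = r ^+ 2.
Proof. by rewrite /sqmod expr0n addr0. Qed.

Lemma sqmod0 : sqmod 0 = 0.
Proof. by rewrite /sqmod /= expr0n addr0. Qed.

Lemma sqmod1 : sqmod 1 = 1.
Proof. by rewrite /sqmod /= expr0n addr0 expr1n. Qed.

Lemma sqmod_eq0 (z : CC) : sqmod z <= 0 -> z = 0.
Proof.
case: z => a b; rewrite /sqmod /= => h.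
have ha := sqr_ge0 a; have hb := sqr_ge0 b.
have /eqP : a ^+ 2 = 0 by lra.
have /eqP : b ^+ 2 = 0 by lra.
by rewrite !expf_eq0 /= => /eqP -> /eqP ->.
Qed.

Lemma ReD (z w : CC) : Rp (z + w) = Rp z + Rp w.
Proof. by case: z; case: w. Qed.

Lemma ReN (z : CC) : Rp (- z) = - Rp z.
Proof. by case: z. Qed.

Lemma Re_mul_conj (z : CC) : Rp (z * (z^*)%C) = sqmod z.
Proof. by case: z => a b; rewrite /sqmod /=; ring. Qed.

Lemma Re_toCM (r : R) (z : CC) : Rp (toC r * z) = r * Rp z.
Proof. by case: z => a b /=; ring. Qed.

Lemma Re_sum (I : Type) (s : seq I) (P : pred I) (F : I -> CC) :
  Rp (\sum_(i <- s | P i) F i) = \sum_(i <- s | P i) Rp (F i).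
Proof. by apply: (big_morph Rp) => // -[a b] [c d]. Qed.

Lemma Re_mul_le (z w : CC) : 2 * Rp (z * w) <= sqmod z + sqmod w.
Proof.
case: z => a b; case: w => c d; rewrite /sqmod /=.
have h1 := sqr_ge0 (a - c); have h2 := sqr_ge0 (b + d); nra.
Qed.

Definition nrm (I : finType) (b : I -> CC) : R := \sum_i sqmod (b i).

Lemma nrm_ge0 (I : finType) (b : I -> CC) : 0 <= nrm b.
Proof. by apply: sumr_ge0 => i _; exact: sqmod_ge0. Qed.

Definition form (I J : finType) (b : I -> CC) (M : I -> J -> CC) (a : J -> CC) : CC :=
  \sum_i \sum_j b i * M i j * a j.

(* By rescaling, this says that the operator norm of M is at most c; the arithmetic-mean
   form avoids square roots. *)
Definition form_le (I J : finType) (M : I -> J -> CC) (c : R) : Prop :=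
  forall b a, 2 * Rp (form b M a) <= c * (nrm b + nrm a).

Lemma form_ext (I J : finType) (b b' : I -> CC) (M M' : I -> J -> CC) (a a' : J -> CC) :
  (forall i j, b i * M i j * a j = b' i * M' i j * a' j) -> form b M a = form b' M' a'.
Proof. by move=> h; apply: eq_bigr => i _; apply: eq_bigr => j _. Qed.

End Modulus.

(** Points may repeat in the families [x] and [y]. Repetition amounts to matrix blocks, so this is a
    completely bounded norm, and pullback along a different map on each side costs nothing. *)
Definition schur_le (R : realType) (X : Type) (k : X -> X -> R[i]) (C : R) : Prop :=
  forall (I J : finType) (x : I -> X) (y : J -> X) (M : I -> J -> R[i]) (c : R),
    0 <= c -> form_le M c -> form_le (fun i j => k (x i) (y j) * M i j) (C * c).

Section Calculus.
Variables (R : realType) (X : Type).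
Local Notation CC := R[i].
Implicit Types (k : X -> X -> CC) (C : R).

Lemma schur_ext k k' C : (forall x y, k x y = k' x y) -> schur_le k C -> schur_le k' C.
Proof.
move=> e h I J x y M c c0 hM b a; move: (h I J x y M c c0 hM b a).
by congr (2 * Rp _ <= _); apply: form_ext => i j; rewrite e.
Qed.

Lemma schur_pull (Y : Type) (g h : Y -> X) k C :
  schur_le k C -> schur_le (fun x y => k (g x) (h y)) C.
Proof. by move=> hk I J x y M c c0 hM; exact: (hk I J (g \o x) (h \o y)). Qed.

Lemma schur_mono k C C' : C <= C' -> schur_le k C -> schur_le k C'.
Proof.
move=> le h I J x y M c c0 hM b a; apply: le_trans (h I J x y M c c0 hM b a) _.
by rewrite ler_wpM2r ?addr_ge0 ?nrm_ge0// ler_wpM2r.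
Qed.

Lemma schur_mul k1 k2 C1 C2 : 0 <= C2 -> schur_le k1 C1 -> schur_le k2 C2 ->
  schur_le (fun x y => k1 x y * k2 x y) (C1 * C2).
Proof.
move=> C20 h1 h2 I J x y M c c0 hM b a; rewrite -[C1 * C2 * c]mulrA.
have h := h1 I J x y _ (C2 * c) (mulr_ge0 C20 c0) (h2 I J x y M c c0 hM) b a.
move: h; congr (2 * Rp _ <= _).
by apply: form_ext => i j; rewrite !mulrA.
Qed.

Lemma schur_add k1 k2 C1 C2 : schur_le k1 C1 -> schur_le k2 C2 ->
  schur_le (fun x y => k1 x y + k2 x y) (C1 + C2).
Proof.
move=> h1 h2 I J x y M c c0 hM b a.
have -> : form b (fun i j => (k1 (x i) (y j) + k2 (x i) (y j)) * M i j) a =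
  form b (fun i j => k1 (x i) (y j) * M i j) a + form b (fun i j => k2 (x i) (y j) * M i j) a.
  rewrite /form -big_split; apply: eq_bigr => i _ /=; rewrite -big_split.
  by apply: eq_bigr => j _ /=; ring.
have e1 := h1 I J x y M c c0 hM b a; have e2 := h2 I J x y M c c0 hM b a.
by rewrite ReD; lra.
Qed.

Lemma schur_opp k C : schur_le k C -> schur_le (fun x y => - k x y) C.
Proof.
move=> h I J x y M c c0 hM b a.
have := h I J x y M c c0 hM (fun i => - b i) a.
have -> : nrm (fun i => - b i) = nrm b by apply: eq_bigr => i _; rewrite sqmodN.
by congr (2 * Rp _ <= _); apply: form_ext => i j; ring.
Qed.

Lemma schur_sub k1 k2 C1 C2 : schur_le k1 C1 -> schur_le k2 C2 ->
  schur_le (fun x y => k1 x y - k2 x y) (C1 + C2).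
Proof. by move=> h1 h2; apply: schur_add h1 (schur_opp h2). Qed.

(* The parameter [s] balances the two families when only the product of the bounds is small. *)
Lemma schur_gram (T : finType) (xi eta : X -> T -> CC) C (s : R) : 0 < s ->
  (forall x, nrm (xi x) <= C * s ^+ 2) -> (forall y, s ^+ 2 * nrm (eta y) <= C) ->
  schur_le (fun x y => \sum_t xi x t * eta y t) C.
Proof.
move=> s0 hxi heta I J x y M c c0 hM b a.
have sn0 : s != 0 by rewrite gt_eqF.
have -> : form b (fun i j => (\sum_t xi (x i) t * eta (y j) t) * M i j) a =
  \sum_t form (fun i => b i * xi (x i) t * toC s^-1) M (fun j => toC s * eta (y j) t * a j).
  rewrite /form [RHS]exchange_big /=; apply: eq_bigr => i _; rewrite [RHS]exchange_big /=.
  apply: eq_bigr => j _; rewrite mulr_suml mulr_sumr mulr_suml; apply: eq_bigr => t _.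
  have e : toC s^-1 * toC s = 1.
    by apply/eqP; rewrite eq_complex /= !mulr0 mul0r addr0 subr0 mulVf // !eqxx.
  transitivity ((b i * xi (x i) t * M i j * eta (y j) t * a j) * (toC s^-1 * toC s)); last by ring.
  by rewrite e; ring.
rewrite Re_sum mulr_sumr.
apply: (@le_trans _ _ (\sum_t c * (nrm (fun i => b i * xi (x i) t * toC s^-1)
   + nrm (fun j => toC s * eta (y j) t * a j)))); first by apply: ler_sum => t _; exact: hM.
rewrite -mulr_sumr [C * c]mulrC -mulrA ler_wpM2l // big_split /= mulrDr.
rewrite /nrm exchange_big [X in _ + X]exchange_big /= !mulr_sumr.
apply: lerD; apply: ler_sum.
- move=> i _.
  rewrite (eq_bigr (fun t => (sqmod (b i) * (s^-1) ^+ 2) * sqmod (xi (x i) t))); last first.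
    by move=> t _; rewrite !sqmodM sqmod_toC; ring.
  rewrite -mulr_sumr -/(nrm _).
  apply: (@le_trans _ _ (sqmod (b i) * s^-1 ^+ 2 * (C * s ^+ 2))).
    by rewrite ler_wpM2l // mulr_ge0 ?sqmod_ge0 ?sqr_ge0.
  by rewrite le_eqVlt; apply/orP; left; apply/eqP; field.
- move=> j _.
  rewrite (eq_bigr (fun t => (sqmod (a j) * s ^+ 2) * sqmod (eta (y j) t))); last first.
    by move=> t _; rewrite !sqmodM sqmod_toC; ring.
  by rewrite -mulr_sumr -/(nrm _) -mulrA mulrC ler_wpM2r ?sqmod_ge0.
Qed.

Lemma schur_const (r : R) : 0 <= r -> schur_le (fun _ _ : X => toC r) r.
Proof.
move=> r0 I J x y M c c0 hM b a.
have -> : form b (fun i j => toC r * M i j) a = toC r * form b M a.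
  rewrite /form mulr_sumr; apply: eq_bigr => i _; rewrite mulr_sumr.
  by apply: eq_bigr => j _; ring.
rewrite Re_toCM mulrCA -mulrA ler_wpM2l //; exact: hM.
Qed.

Lemma schur_scale k C (r : R) : 0 <= r -> 0 <= C ->
  schur_le k C -> schur_le (fun x y => toC r * k x y) (r * C).
Proof. by move=> r0 C0 h; apply: schur_mul => //; exact: schur_const. Qed.

Lemma schur_1 : schur_le (fun _ _ : X => 1 : CC) 1.
Proof. exact: (@schur_const 1). Qed.

Lemma schur_0 : schur_le (fun _ _ : X => 0 : CC) 0.
Proof. exact: (@schur_const 0). Qed.

Lemma schur_sum (L : Type) (s : seq L) (k : L -> X -> X -> CC) (C : L -> R) :
  (forall l, schur_le (k l) (C l)) ->
  schur_le (fun x y => \sum_(l <- s) k l x y) (\sum_(l <- s) C l).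
Proof.
move=> h; elim: s => [|l s IH].
  by rewrite big_nil; apply: schur_ext schur_0 => x y; rewrite big_nil.
rewrite big_cons; apply: schur_ext (schur_add (h l) IH) => x y.
by rewrite big_cons.
Qed.

Lemma schur_prod (L : Type) (s : seq L) (k : L -> X -> X -> CC) (C : R) : 0 <= C ->
  (forall l, schur_le (k l) C) ->
  schur_le (fun x y => \prod_(l <- s) k l x y) (C ^+ size s).
Proof.
move=> C0 h; elim: s => [|l s IH].
  by apply: schur_ext schur_1 => x y; rewrite big_nil.
rewrite exprS; apply: schur_ext (schur_mul (exprn_ge0 _ C0) (h l) IH) => x y.
by rewrite big_cons.
Qed.

Lemma schur_mul_diff k1 k2 k1' k2' C d1 d2 :
  1 <= C -> 0 <= d1 -> 0 <= d2 ->
  schur_le k1 C -> schur_le k2' C ->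
  schur_le (fun x y => k1 x y - k1' x y) d1 -> schur_le (fun x y => k2 x y - k2' x y) d2 ->
  schur_le (fun x y => k1 x y * k2 x y - k1' x y * k2' x y) (C * (d1 + d2)).
Proof.
move=> C1 d10 d20 h1 h2 e1 e2; have C0 : 0 <= C by lra.
have h := schur_add (schur_mul d20 h1 e2) (schur_mul C0 e1 h2).
apply: schur_mono (schur_ext _ h); first by rewrite mulrDr [d1 * C]mulrC addrC.
by move=> x y; ring.
Qed.

(** Telescoping: factors are exchanged one at a time, so the cost is linear in [d]. The assumption
    [1 <= C] allows the uniform power [C ^+ size s]. *)
Lemma schur_prod_diff (L : Type) (s : seq L) (k k' : L -> X -> X -> CC) (C d : R) :
  1 <= C -> 0 <= d ->
  (forall l, schur_le (k l) C) -> (forall l, schur_le (k' l) C) ->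
  (forall l, schur_le (fun x y => k l x y - k' l x y) d) ->
  schur_le (fun x y => \prod_(l <- s) k l x y - \prod_(l <- s) k' l x y)
    ((size s)%:R * C ^+ size s * d).
Proof.
move=> C1 d0 hk hk' hd; have C0 : 0 <= C by lra.
elim: s => [|l s IH].
  by rewrite mul0r mul0r; apply: schur_ext schur_0 => x y; rewrite !big_nil subrr.
have h := schur_add (schur_mul (mulr_ge0 (mulr_ge0 (ler0n _ _) (exprn_ge0 _ C0)) d0) (hk l) IH)
   (schur_mul (exprn_ge0 _ C0) (hd l) (schur_prod s C0 hk')).
apply: schur_mono (schur_ext _ h); last by move=> x y; rewrite !big_cons; ring.
rewrite /= exprS -[(size s).+1]addn1 natrD.
have hp : 0 <= C ^+ size s by exact: exprn_ge0.
have hq : 0 <= d * C ^+ size s by exact: mulr_ge0.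
nra.
Qed.

End Calculus.

(** The bound tests finitely many points at a time. Since [k'] may depend on [s], finite-dimensional
    vectors and finite products can stand in for infinite ones. *)
Lemma schur_local (R : realType) (X : eqType) (k : X -> X -> R[i]) (C : R) :
  (forall s : seq X, exists2 k', schur_le k' C &
     {in s &, forall x y, k x y = k' x y}) -> schur_le k C.
Proof.
move=> h I J x y M c c0 hM b a.
have [k' hk' e] := h ([seq x i | i <- enum I] ++ [seq y j | j <- enum J]).
have := hk' I J x y M c c0 hM b a; congr (2 * Rp _ <= _); apply: form_ext => i j.
rewrite e // mem_cat; apply/orP; [left|right]; apply/mapP.
  by exists i; rewrite ?mem_enum.
by exists j; rewrite ?mem_enum.
Qed.

Lemma schur_delta (R : realType) (X : eqType) :
  schur_le (fun x y : X => (x == y)%:R : R[i]) 1.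
Proof.
apply: schur_local => s.
pose T : finType := 'I_(size s).
(* Basis vectors indexed by positions in [s]. Outside [s] the index is [size s], which no [t]
   attains, so the vector is zero. *)
pose xi (x : X) (t : T) : R[i] := (val t == index x s)%:R.
exists (fun x y => \sum_t xi x t * xi y t).
- have h x : nrm (xi x) <= 1.
    rewrite /nrm; case: (ltnP (index x s) (size s)) => hx.
      rewrite (bigD1 (Ordinal hx)) //= /xi eqxx sqmod1 big1 ?addr0 //.
      by move=> i; rewrite -val_eqE /= => /negPf ->; rewrite sqmod0.
    rewrite big1 // => i _; rewrite /xi; case: eqP => e; last by rewrite sqmod0.
    by have := ltn_ord i; rewrite [nat_of_ord i]e ltnNge hx.
  by apply: (@schur_gram _ _ _ _ _ _ 1) => // x; rewrite ?expr1n ?mulr1 ?mul1r.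
- move=> x y sx sy; have hx := sx; rewrite -index_mem in hx.
  rewrite (bigD1 (Ordinal hx)) //= big1 ?addr0.
    rewrite /xi /= eqxx mul1r; congr (nat_of_bool _)%:R; apply/eqP/eqP => [->//|e].
    by rewrite -(nth_index x sx) e nth_index.
  by move=> i; rewrite -val_eqE /= /xi => /negPf ->; rewrite mul0r.
Qed.

(** * Separation from a convex cone *)

Section Cone.
Variables (R : realType) (I : finType).
Notation V := (I -> R).
Implicit Types (K : V -> Prop) (e v b : V).

Definition convex_cone K : Prop :=
  [/\ K (fun=> 0), forall x y, K x -> K y -> K (fun i => x i + y i) &
      forall (t : R) x, 0 <= t -> K x -> K (fun i => t * x i)].

Definition order_unit K e : Prop := forall v, exists l : R, K (fun i => l * e i + v i).

(** One step of a Hahn-Banach extension: [a] is the value at [b] of a positive functional equal to 1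
    at [e]. The least value that positivity allows is the supremum of all [a] with [b - a e] in [K];
    the order unit makes this set nonempty and bounded. *)
Lemma cone_step K e b : convex_cone K -> order_unit K e -> ~ K (fun i => - e i) ->
  exists a : R, ~ exists t : R, K (fun i => - e i + t * (b i - a * e i)).
Proof.
move=> [K0 KD KZ] ou ne.
pose S : set R := fun a => K (fun i => b i - a * e i).
have neg (t : R) : t < 0 -> ~ K (fun i => t * e i).
  move=> t0 h; apply: ne.
  have := KZ (- t^-1) _ _ h; rewrite oppr_ge0 invr_le0 ltW // => /(_ isT).
  by congr K; apply: funext => i; field; rewrite lt_eqF.
have below (a a' : R) : a' < a -> S a -> ~ K (fun i => a' * e i - b i).
  move=> la Sa h; apply: (@neg (a' - a)); first by rewrite subr_lt0.
  by have := KD _ _ h Sa; congr K; apply: funext => i; ring.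
have [l hl] := ou (fun i => - b i).
have Sub : ubound S l.
  by move=> a Sa; rewrite leNgt; apply/negP => la; exact: (below _ _ la Sa).
have [l0 hl0] := ou b.
have Sne : S (- l0) by move: hl0; congr K; apply: funext => i; ring.
have hS : has_sup S by split; [exists (- l0)|exists l].
exists (sup S) => -[t ht].
(* For [t < 0] the cone contains [a e - b] with [a] below the supremum, against an element of [S]
   above [a]; for [t > 0] it contains [b - a e] with [a] above the supremum. *)
have [t0|t0|t0] := ltgtP t 0.
- have h := KZ (- t^-1) _ _ ht; rewrite oppr_ge0 invr_le0 ltW // in h.
  have [|a Sa la] := @sup_adherent _ S (- t^-1) _ hS; first by rewrite oppr_gt0 invr_lt0.
  apply: (below _ _ _ Sa); first exact: la.
  by move: (h isT); congr K; apply: funext => i; field; rewrite lt_eqF.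
- have h := KZ (t^-1) _ _ ht; rewrite invr_ge0 ltW // in h.
  have : S (sup S + t^-1).
    by move: (h isT); congr K; apply: funext => i; field; rewrite gt_eqF.
  move=> /(ub_le_sup hS.2); have : 0 < t^-1 by rewrite invr_gt0.
  by lra.
- by apply: ne; move: ht; congr K; rewrite t0; apply: funext => i; ring.
Qed.

(** Adjoining the line through [b - a e] makes [b] a multiple of [e] modulo vectors that lie in the
    cone together with their negatives. On the span of the list the enlarged cone thus determines a
    linear functional. *)
Lemma cone_extension K e (bs : seq V) : convex_cone K -> order_unit K e ->
  ~ K (fun i => - e i) ->
  exists K', [/\ convex_cone K', forall v, K v -> K' v, ~ K' (fun i => - e i) &
    forall k, (k < size bs)%N -> exists a : R,
      K' (fun i => nth (fun=> 0) bs k i - a * e i) /\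
      K' (fun i => a * e i - nth (fun=> 0) bs k i)].
Proof.
elim: bs K => [|b bs IH] K cK ou ne.
  by exists K; split.
have [a na] := cone_step b cK ou ne.
case: (cK) => [K0 KD KZ].
pose K1 (v : V) := exists t : R, K (fun i => v i + t * (b i - a * e i)).
have K1K v : K v -> K1 v.
  by move=> h; exists 0; move: h; congr K; apply: funext => i; ring.
have cK1 : convex_cone K1.
  split; first exact: K1K.
    move=> x y [t ht] [s hs]; exists (t + s).
    by move: (KD _ _ ht hs); congr K; apply: funext => i; ring.
  move=> r x r0 [t ht]; exists (r * t).
  by move: (KZ r _ r0 ht); congr K; apply: funext => i; ring.
have ou1 : order_unit K1 e by move=> v; have [l hl] := ou v; exists l; exact: K1K.
have [K' [cK' sK' nK' hK']] := IH K1 cK1 ou1 na.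
exists K'; split=> //; first by move=> v /K1K /sK'.
case=> [_|k hk]; last exact: hK'.
exists a; split; apply: sK'; [exists (-1)|exists 1];
  by move: K0; congr K; apply: funext => i /=; ring.
Qed.

Definition bas (i : I) : V := fun j => (j == i)%:R.

Lemma basE (v : V) : v = (fun j => \sum_i v i * bas i j).
Proof.
apply: funext => j; rewrite (bigD1 j) //= /bas eqxx mulr1 big1 ?addr0 //.
by move=> i /negPf ij; rewrite eq_sym ij mulr0.
Qed.

(** Adjoining [- v0] forces a nonpositive value at [v0]; one line for each basis vector then
    determines the coefficients [al]. The cone is not assumed closed, hence the inequality at [v0]
    is weak. *)
Lemma cone_functional K e v0 : convex_cone K -> order_unit K e -> K e -> ~ K v0 ->
  exists al : I -> R, [/\ forall v, K v -> 0 <= \sum_i v i * al i,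
    \sum_i v0 i * al i <= 0 & \sum_i e i * al i = 1].
Proof.
move=> cK ou Ke nv0; case: (cK) => [K0 KD KZ].
have nKe : ~ K (fun i => - e i).
  move=> h; apply: nv0; have [l hl] := ou v0.
  have [l0|l0] := leP 0 l.
    by move: (KD _ _ hl (KZ l _ l0 h)); congr K; apply: funext => i; ring.
  have l0' : 0 <= - l by rewrite oppr_ge0 ltW.
  by move: (KD _ _ hl (KZ _ _ l0' Ke)); congr K; apply: funext => i; ring.
pose K1 (v : V) := exists2 t : R, 0 <= t & K (fun i => v i + t * v0 i).
have K1K v : K v -> K1 v.
  by move=> h; exists 0 => //; move: h; congr K; apply: funext => i; ring.
have cK1 : convex_cone K1.
  split; first exact: K1K.
    move=> x y [t t0 ht] [s s0 hs]; exists (t + s); first exact: addr_ge0.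
    by move: (KD _ _ ht hs); congr K; apply: funext => i; ring.
  move=> r x r0 [t t0 ht]; exists (r * t); first exact: mulr_ge0.
  by move: (KZ r _ r0 ht); congr K; apply: funext => i; ring.
have ou1 : order_unit K1 e by move=> v; have [l hl] := ou v; exists l; exact: K1K.
have ne1 : ~ K1 (fun i => - e i).
  move=> [t]; rewrite le_eqVlt => /orP[/eqP <- h|t0 h].
    by apply: nKe; move: h; congr K; apply: funext => i; ring.
  apply: nv0; have ti : 0 <= t^-1 by rewrite invr_ge0 ltW.
  move: (KZ _ _ ti (KD _ _ h Ke)); congr K; apply: funext => i; field.
  by rewrite gt_eqF.
have [K' [cK' sK' nK' hK']] := cone_extension [seq bas i | i <- enum I] cK1 ou1 ne1.
case: (cK') => [K'0 K'D K'Z].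
have /boolp.choice [al hal] : forall i, exists a : R,
   K' (fun j => bas i j - a * e j) /\ K' (fun j => a * e j - bas i j).
  move=> i; have := hK' (index i (enum I)).
  rewrite size_map index_mem mem_enum => /(_ isT).
  by rewrite (nth_map i) ?index_mem ?mem_enum // nth_index ?mem_enum.
(* Modulo [K'] and its negative, a vector equals its functional value times [e]. Cones admit
   nonnegative multiples only, so a negative [v i] exchanges the two halves of [hal]. *)
have lin v : K' (fun j => (\sum_i v i * al i) * e j - v j) /\
             K' (fun j => v j - (\sum_i v i * al i) * e j).
  have gen (s : seq I) : K' (fun j => (\sum_(i <- s) v i * al i) * e j
            - \sum_(i <- s) v i * bas i j) /\
          K' (fun j => \sum_(i <- s) v i * bas i j - (\sum_(i <- s) v i * al i) * e j).
    elim: s => [|i s [IH1 IH2]].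
      by split; move: K'0; congr K'; apply: funext => j; rewrite !big_nil; ring.
    have [h1 h2] := hal i.
    have [vi|vi] := leP 0 (v i).
      split.
        move: (K'D _ _ IH1 (K'Z _ _ vi h2)); congr K'; apply: funext => j.
        by rewrite !big_cons; ring.
      move: (K'D _ _ IH2 (K'Z _ _ vi h1)); congr K'; apply: funext => j.
      by rewrite !big_cons; ring.
    have vi' : 0 <= - v i by rewrite oppr_ge0 ltW.
    split.
      move: (K'D _ _ IH1 (K'Z _ _ vi' h1)); congr K'; apply: funext => j.
      by rewrite !big_cons; ring.
    move: (K'D _ _ IH2 (K'Z _ _ vi' h2)); congr K'; apply: funext => j.
    by rewrite !big_cons; ring.
  by have [h1 h2] := gen (index_enum I); split; [move: h1|move: h2]; congr K';
    apply: funext => j; congr (_ - _); rewrite [in RHS](basE v).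
have pos (r : R) : K' (fun j => r * e j) -> 0 <= r.
  move=> h; rewrite leNgt; apply/negP => r0; apply: nK'.
  have := K'Z (- r^-1) _ _ h; rewrite oppr_ge0 invr_le0 ltW // => /(_ isT).
  by congr K'; apply: funext => i; field; rewrite lt_eqF.
exists al; split.
- move=> v Kv; apply: pos; move: (K'D _ _ (lin v).1 (sK' _ (K1K _ Kv))).
  by congr K'; apply: funext => j; ring.
- have h : K1 (fun i => - v0 i).
    by exists 1 => //; move: K0; congr K; apply: funext => i; ring.
  rewrite -oppr_ge0; apply: pos; move: (K'D _ _ (lin v0).2 (sK' _ h)).
  by congr K'; apply: funext => j; ring.
- have h1 : 0 <= \sum_i e i * al i - 1.
    by apply: pos; move: (lin e).1; congr K'; apply: funext => j; ring.
  have h2 : 0 <= 1 - \sum_i e i * al i.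
    by apply: pos; move: (lin e).2; congr K'; apply: funext => j; ring.
  by lra.
Qed.

End Cone.

(** * Duality and factorization of Schur multipliers *)

Lemma complex_split (R : realType) (z : R[i]) : z = Complex (Rp z) (Ip z).
Proof. by case: z. Qed.

Section Factorization.
Variables (R : realType) (S : finType).
Local Notation CC := R[i].

Notation idx := ((S + S) + (S * S + S * S))%type.
Local Notation rowi i := (inl (inl i) : idx).
Local Notation coli j := (inl (inr j) : idx).
Local Notation rei p := (inr (inl p) : idx).
Local Notation imi p := (inr (inr p) : idx).

(** The trace of positive semidefinite two by two block matrices on their diagonal and off-diagonal
    block, with the diagonal allowed to grow. Complex entries are split into real coordinates for
    the separation. Since [T] is free, direct sums add such vectors. *)
Definition factors (v : idx -> R) : Prop :=
  exists (T : finType) (xi eta : S -> T -> CC),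
    [/\ forall i, nrm (xi i) <= v (rowi i), forall j, nrm (eta j) <= v (coli j) &
        forall i j, \sum_t xi i t * eta j t = Complex (v (rei (i, j))) (v (imi (i, j)))].

Lemma nrm_scale (T : finType) (r : R) (f : T -> CC) :
  nrm (fun t => toC r * f t) = r ^+ 2 * nrm f.
Proof. by rewrite /nrm mulr_sumr; apply: eq_bigr => t _; rewrite sqmodM sqmod_toC. Qed.

Lemma factors_diag (v : idx -> R) : (forall i, 0 <= v (rowi i)) ->
  (forall j, 0 <= v (coli j)) -> (forall p, v (rei p) = 0) -> (forall p, v (imi p) = 0) ->
  factors v.
Proof.
move=> h1 h2 h3 h4; exists void, (fun _ _ => 0), (fun _ _ => 0); split=> [i|j|i j].
- by rewrite /nrm big1 // => -[].
- by rewrite /nrm big1 // => -[].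
- by rewrite big1 ?h3 ?h4 // => -[].
Qed.

Lemma factors_cone : convex_cone factors.
Proof.
split; first exact: factors_diag.
- move=> x y [T1 [xi1 [eta1 [a1 b1 c1]]]] [T2 [xi2 [eta2 [a2 b2 c2]]]].
  exists (T1 + T2)%type.
  exists (fun i t => match t with inl t => xi1 i t | inr t => xi2 i t end).
  exists (fun i t => match t with inl t => eta1 i t | inr t => eta2 i t end).
  split=> [i|j|i j]; rewrite /nrm big_sumType /=.
  + exact: lerD (a1 i) (a2 i).
  + exact: lerD (b1 j) (b2 j).
  + by rewrite c1 c2.
- move=> t x t0 [T [xi [eta [a b c]]]].
  exists T, (fun i s => toC (Num.sqrt t) * xi i s), (fun i s => toC (Num.sqrt t) * eta i s).
  split=> [i|j|i j].
  + by rewrite nrm_scale sqr_sqrtr // ler_wpM2l.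
  + by rewrite nrm_scale sqr_sqrtr // ler_wpM2l.
  + rewrite (eq_bigr (fun s => toC t * (xi i s * eta j s))); last first.
      move=> s _; rewrite mulrACA; congr (_ * _).
      by rewrite -{3}(sqr_sqrtr t0) expr2; apply/eqP; rewrite eq_complex /=; apply/andP; split;
         apply/eqP; ring.
    rewrite -mulr_sumr c; apply/eqP; rewrite eq_complex /=; apply/andP; split; apply/eqP; ring.
Qed.

Definition diag_unit (k : idx) : R := if k is inl _ then 1 else 0.

Lemma factors_order_unit : order_unit factors diag_unit.
Proof.
move=> v.
pose z i j : CC := Complex (v (rei (i, j))) (v (imi (i, j))).
exists (1 + \sum_k `|v k| + \sum_i \sum_j sqmod (z i j)).
have vb k : - v k <= \sum_k `|v k|.
  by rewrite (bigD1 k) //= (le_trans (ler_norm _)) // normrN lerDl sumr_ge0.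
have zb i : nrm (z i) <= \sum_i \sum_j sqmod (z i j).
  by rewrite [leRHS](bigD1 i) //= lerDl; apply: sumr_ge0 => k _; exact: (nrm_ge0 (z k)).
exists S, z, (fun j t => (t == j)%:R); split=> [i|j|i j] /=.
- by have := vb (rowi i); have := zb i; lra.
- have -> : nrm (fun t => (t == j)%:R : CC) = 1.
    rewrite /nrm (bigD1 j) //= eqxx sqmod1 big1 ?addr0 // => i /negPf ->; exact: sqmod0.
  have := vb (coli j).
  have : 0 <= \sum_i \sum_j sqmod (z i j) by apply: sumr_ge0 => i _; exact: (nrm_ge0 (z i)).
  by lra.
- rewrite (bigD1 j) //= eqxx mulr1 big1 ?addr0 ?mulr0 ?add0r // => t /negPf ->.
  by rewrite mulr0.
Qed.

(* Duality for the Schur multiplier norm: otherwise a functional separates w from the cone of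
   factorized matrices, and its off-diagonal part, rescaled by its diagonal part, is a matrix
   on which the multiplier w exceeds the bound C. *)
Lemma schur_factorization (w : S -> S -> CC) (C C' : R) : 0 <= C -> C < C' ->
  (forall (M : S -> S -> CC) c, 0 <= c -> form_le M c ->
     form_le (fun i j => w i j * M i j) (C * c)) ->
  exists (T : finType) (xi eta : S -> T -> CC),
    [/\ forall i, nrm (xi i) <= C', forall j, nrm (eta j) <= C' &
        forall i j, w i j = \sum_t xi i t * eta j t].
Proof.
move=> C0 CC' hw.
pose v0 (k : idx) : R := match k with
  | inl _ => C' | inr (inl (i, j)) => Rp (w i j) | inr (inr (i, j)) => Ip (w i j) end.
suff : factors v0.
  move=> [T [xi [eta [a b c]]]]; exists T, xi, eta; split=> // i j.
  by rewrite c /= -complex_split.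
apply: contrapT => nv0.
have Ku : factors diag_unit by apply: factors_diag.
have [al [al_ge0 al_v0 al_u]] := cone_functional factors_cone factors_order_unit Ku nv0.
pose p i := al (rowi i); pose q j := al (coli j).
(* The conjugate makes [Rp (f i j * z)] the pairing of [al] with the real and imaginary parts of
   [z]. *)
pose f i j : CC := Complex (al (rei (i, j))) (- al (imi (i, j))).
have sumidx (F : idx -> R) : \sum_k F k = \sum_i F (rowi i) + \sum_j F (coli j)
    + (\sum_i \sum_j F (rei (i, j)) + \sum_i \sum_j F (imi (i, j))).
  rewrite big_sumType /= !big_sumType /= !pair_big /=; congr (_ + (_ + _));
  by apply: eq_bigr => -[].
have pq1 : \sum_i p i + \sum_j q j = 1.
  rewrite -[RHS]al_u sumidx /=.
  rewrite [X in _ = _ + (X + _)]big1 ?[X in _ = _ + (_ + X)]big1 ?addr0.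
  - by congr (_ + _); apply: eq_bigr => i _; rewrite mul1r.
  - by move=> i _; apply: big1 => j _; rewrite mul0r.
  - by move=> i _; apply: big1 => j _; rewrite mul0r.
have p0 i : 0 <= p i.
  have -> : p i = \sum_k bas R (rowi i) k * al k.
    rewrite (bigD1 (rowi i)) //= /bas eqxx mul1r big1 ?addr0 // => k /negPf ->.
    by rewrite mul0r.
  by apply: al_ge0; apply: factors_diag => // j; exact: ler0n.
have q0 i : 0 <= q i.
  have -> : q i = \sum_k bas R (coli i) k * al k.
    rewrite (bigD1 (coli i)) //= /bas eqxx mul1r big1 ?addr0 // => k /negPf ->.
    by rewrite mul0r.
  by apply: al_ge0; apply: factors_diag => // j; exact: ler0n.
have Ref (z : CC) i j : Rp (f i j * z) = Rp z * al (rei (i, j)) + Ip z * al (imi (i, j)).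
  by case: z => x y /=; ring.
(* Positivity on factorizations through one dimension bounds the form of [f] by the diagonal weights
   [p] and [q]. *)
have rank1 (b a : S -> CC) :
    0 <= \sum_i p i * sqmod (b i) + \sum_j q j * sqmod (a j) + Rp (form b f a).
  pose v (k : idx) : R := match k with
   | inl (inl i) => sqmod (b i) | inl (inr j) => sqmod (a j)
   | inr (inl (i, j)) => Rp (b i * a j) | inr (inr (i, j)) => Ip (b i * a j) end.
  have Kv : factors v.
    exists unit, (fun i _ => b i), (fun j _ => a j); split=> [i|j|i j].
    - by rewrite /nrm big_const card_unit /= addr0.
    - by rewrite /nrm big_const card_unit /= addr0.
    - by rewrite big_const card_unit /= addr0 -complex_split.
  have := al_ge0 _ Kv; rewrite sumidx /=; congr (_ <= _ + _ + _).
  - by apply: eq_bigr => i _; rewrite mulrC.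
  - by apply: eq_bigr => i _; rewrite mulrC.
  - rewrite -big_split /= /form Re_sum; apply: eq_bigr => i _.
    rewrite -big_split /= Re_sum; apply: eq_bigr => j _.
    by rewrite -Ref; congr Rp; ring.
pose n : R := #|S|%:R.
(* The weights may vanish, so they are raised by [tau] before their square roots are inverted. This
   [tau] keeps the resulting loss [2 * n * tau * C] below [C' - C]. *)
pose tau := (C' - C) / (2 * (2 * n * C + 1)).
have n0 : 0 <= n by exact: ler0n.
have nC0 : 0 <= n * C by exact: mulr_ge0.
have tau0 : 0 < tau by rewrite divr_gt0 //; lra.
have etau : tau * (2 * (2 * n * C + 1)) = C' - C by rewrite /tau; field; lra.
pose sp i := Num.sqrt (p i + tau); pose sq j := Num.sqrt (q j + tau).
have sp2 i : sp i ^+ 2 = p i + tau by rewrite sqr_sqrtr //; have := p0 i; lra.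
have sq2 i : sq i ^+ 2 = q i + tau by rewrite sqr_sqrtr //; have := q0 i; lra.
have sp0 i : sp i != 0 by rewrite gt_eqF // sqrtr_gt0; have := p0 i; lra.
have sq0 i : sq i != 0 by rewrite gt_eqF // sqrtr_gt0; have := q0 i; lra.
pose M i j : CC := - toC (sp i)^-1 * f i j * toC (sq j)^-1.
have hM : form_le M 2.
  move=> b a.
  have := rank1 (fun i => toC (sp i)^-1 * b i) (fun j => toC (sq j)^-1 * a j).
  have -> : form (fun i => toC (sp i)^-1 * b i) f (fun j => toC (sq j)^-1 * a j)
     = - form b M a.
    rewrite /form -sumrN; apply: eq_bigr => i _; rewrite -sumrN; apply: eq_bigr => j _.
    by rewrite /M; ring.
  have h1 : \sum_i p i * sqmod (toC (sp i)^-1 * b i) <= nrm b.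
    apply: ler_sum => i _; rewrite sqmodM sqmod_toC mulrA exprVn sp2.
    have := p0 i => hp; rewrite ler_piMl ?sqmod_ge0 // ler_pdivrMr ?mul1r; lra.
  have h2 : \sum_i q i * sqmod (toC (sq i)^-1 * a i) <= nrm a.
    apply: ler_sum => i _; rewrite sqmodM sqmod_toC mulrA exprVn sq2.
    have := q0 i => hq; rewrite ler_piMl ?sqmod_ge0 // ler_pdivrMr ?mul1r; lra.
  rewrite ReN; lra.
(* Tested on the square roots of the weights, [w * M] undoes the rescaling and leaves minus the
   pairing of [f] with [w]; by [al_v0] that pairing has real part at most [- C']. *)
have := hw M 2 _ hM (fun i => toC (sp i)) (fun j => toC (sq j)).
have -> : nrm (fun i => toC (sp i)) = \sum_i p i + n * tau.
  rewrite /nrm (eq_bigr (fun i => p i + tau)); last by move=> i _; rewrite sqmod_toC sp2.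
  by rewrite big_split sumr_const /= mulr_natl.
have -> : nrm (fun i => toC (sq i)) = \sum_i q i + n * tau.
  rewrite /nrm (eq_bigr (fun i => q i + tau)); last by move=> i _; rewrite sqmod_toC sq2.
  by rewrite big_split sumr_const /= mulr_natl.
have -> : form (fun i => toC (sp i)) (fun i j => w i j * M i j) (fun j => toC (sq j))
   = - \sum_i \sum_j f i j * w i j.
  rewrite /form -sumrN; apply: eq_bigr => i _; rewrite -sumrN; apply: eq_bigr => j _.
  have e (r : R) : r != 0 -> toC r * toC r^-1 = 1.
    by move=> rn0; apply/eqP; rewrite eq_complex /= !mulr0 mul0r addr0 subr0 divff // !eqxx.
  transitivity (- (toC (sp i) * toC (sp i)^-1) * (toC (sq j) * toC (sq j)^-1) * (f i j * w i j)).
    by rewrite /M; ring.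
  by rewrite !e //; ring.
have : \sum_k v0 k * al k = C' + Rp (\sum_i \sum_j f i j * w i j).
  rewrite sumidx /= -!mulr_sumr -mulrDr pq1 mulr1 -big_split Re_sum /=; congr (_ + _).
  apply: eq_bigr => i _; rewrite -big_split Re_sum /=; apply: eq_bigr => j _.
  by rewrite Ref.
move: al_v0; rewrite ReN => h1 h2; rewrite {}h2 in h1 => /(_ (ler0n _ 2)) h3.
move: etau h1 h3 pq1; set P := \sum_i p i; set Q := \sum_j q j.
set W := Rp _ => etau h1 h3 pq1.
have h4 : 2 * - W <= C * 2 * (1 + 2 * (n * tau)).
  have e : P + n * tau + (Q + n * tau) = (P + Q) + 2 * (n * tau) by ring.
  by move: h3; rewrite e pq1.
lra.
Qed.
End Factorization.

(** * From an almost contractive kernel to a positive definite one *)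

Lemma nrm_conj (R : realType) (T : finType) (f : T -> R[i]) : nrm (fun t => (f t)^*) = nrm f.
Proof. by apply: eq_bigr => t _; rewrite sqmod_conj. Qed.

Lemma nrm_sub_conj (R : realType) (T : finType) (f g : T -> R[i]) :
  nrm (fun t => f t - (g t)^*) = nrm f + nrm g - 2 * Rp (\sum_t f t * g t).
Proof.
rewrite Re_sum mulr_sumr /nrm -big_split -sumrB; apply: eq_bigr => t _ /=.
by case: (f t) => a b; case: (g t) => c d; rewrite /sqmod /=; ring.
Qed.

(** The difference is a sum of three Gram kernels, each with one short vector: [eta] against the
    conjugate of [xi], then [xi] against its normalization [xh] on either side. Short vectors have
    squared norm at most [2 t^3], the others at most 2; balanced by [t] or its inverse in
    [schur_gram], each kernel costs [2 t]. *)
Lemma schur_near_positive (R : realType) (A : choiceType) (p0 : A) (v : A -> A -> R[i])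
    (t : R) (s : seq A) :
  0 < t < 1 -> schur_le v (1 + t ^+ 3 / 2) -> (forall p, v p p = 1) ->
  exists v' u : A -> A -> R[i],
    [/\ {in s &, forall p q, v p q = v' p q}, (forall p, v' p p = 1) /\ (forall p, u p p = 1),
        schur_le v' 2, schur_le u 1 & schur_le (fun p q => v' p q - u p q) (6 * t)].
Proof.
move=> /andP[t0 t1] hv v1.
pose k := t ^+ 3.
have k0 : 0 < k by rewrite exprn_gt0.
have kt : k <= t.
  by rewrite /k exprS ler_piMr ?exprn_ile1 ?ltW.
pose S := seq_sub (p0 :: s).
have p0S : p0 \in p0 :: s by rewrite mem_head.
(* The kernel [v'] will be [v] pulled back along this retraction onto the finite set, with default
   point [p0]; so it has the value 1 on the whole diagonal. *)
pose rho (p : A) : S := insubd (SeqSub p0S) p.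
have rhoK p : p \in s -> ssval (rho p) = p.
  by move=> ps; rewrite /rho; apply: (insubdK (SeqSub p0S)); rewrite unfold_in /= inE ps orbT.
(* Half of [k] is reserved for the strict inequality in the factorization. *)
have [||M c c0 hM|T [xi0 [eta0 [nx ne e]]]] :=
  @schur_factorization R S (fun i j => v (ssval i) (ssval j)) (1 + k / 2) (1 + k).
- by lra.
- by lra.
- exact: (hv S S (@ssval _ _) (@ssval _ _)).
pose xi p := xi0 (rho p); pose eta p := eta0 (rho p).
have nxi p : nrm (xi p) <= 1 + k by exact: nx.
have neta p : nrm (eta p) <= 1 + k by exact: ne.
have diag p : \sum_t xi p t * eta p t = 1 by rewrite -e v1.
have nd p : nrm (fun t => xi p t - (eta p t)^*) <= 2 * k.
  by rewrite nrm_sub_conj diag /=; have := nxi p; have := neta p; lra.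
have nxi' p : 1 - k <= nrm (xi p).
  have := nrm_ge0 (fun t => xi p t - (eta p t)^*).
  by rewrite nrm_sub_conj diag /=; have := neta p; lra.
pose n p := Num.sqrt (nrm (xi p)).
have n2 p : n p ^+ 2 = nrm (xi p) by rewrite sqr_sqrtr // nrm_ge0.
have n_ge0 p : 0 <= n p by exact: sqrtr_ge0.
have n0 p : 0 < n p.
  rewrite lt_neqAle n_ge0 andbT eq_sym; apply/eqP => h; have := nxi' p; rewrite -n2 h expr0n /=; lra.
pose xh p (t : T) := toC (n p)^-1 * xi p t.
have nxh p : nrm (xh p) = 1.
  by rewrite nrm_scale exprVn n2 mulVf // -n2 expf_neq0 // gt_eqF.
(* With [n = n p] positive, [(n - 1)^2 <= |n^2 - 1| <= k]. *)
have nxd p : nrm (fun t => xi p t - xh p t) <= k.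
  have -> : nrm (fun t => xi p t - xh p t) = (n p - 1) ^+ 2.
    transitivity (nrm (fun t => toC (1 - (n p)^-1) * xi p t)).
      congr nrm; apply: funext => t'; rewrite /xh -{1}[xi p t']mul1r -mulrBl; congr (_ * _).
      by apply/eqP; rewrite eq_complex /= subr0 !eqxx.
    rewrite nrm_scale -n2; field; exact: lt0r_neq0.
  have h1 : (n p - 1) * (n p + 1) <= k by have := nxi p; rewrite -n2; lra.
  have h2 : - k <= (n p - 1) * (n p + 1) by have := nxi' p; rewrite -n2; lra.
  have k1 : k <= 1 by lra.
  have h3 := n0 p; nra.
exists (fun p q => \sum_t xi p t * eta q t), (fun p q => \sum_t xh p t * (xh q t)^*).
split.
- by move=> p q ps qs; rewrite -e !rhoK.
- split=> // p; transitivity (toC (nrm (xh p))); last by rewrite nxh.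
  rewrite /nrm (big_morph (fun r : R => toC r) (id1 := 0) (op1 := +%R)) //.
    by apply: eq_bigr => i _; case: (xh p i) => a b; apply/eqP; rewrite eq_complex /sqmod /=;
      apply/andP; split; apply/eqP; ring.
  by move=> a b; apply/eqP; rewrite eq_complex /= addr0 !eqxx.
- apply: (@schur_gram _ _ _ _ _ _ 1) => // p; rewrite expr1n ?mulr1 ?mul1r.
    by apply: le_trans (nxi p) _; lra.
  by apply: le_trans (neta p) _; lra.
- by apply: (@schur_gram _ _ _ _ _ _ 1) => // p; rewrite expr1n ?mulr1 ?mul1r ?nrm_conj nxh.
have t20 : 0 < t ^+ 2 by rewrite exprn_gt0.
have tn0 : t != 0 by rewrite gt_eqF.
have k3 : k = t * t ^+ 2 by rewrite /k exprS.
have big_s (f : T -> R[i]) : nrm f <= 1 + k -> nrm f <= 2 * t * t^-1 ^+ 2.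
  move=> h; apply: le_trans h _.
  have -> : 2 * t * t^-1 ^+ 2 = 2 * t^-1 by field.
  have : 1 <= t^-1 by rewrite invf_ge1 // ltW.
  lra.
have small_s (f : T -> R[i]) : nrm f <= 2 * k -> t^-1 ^+ 2 * nrm f <= 2 * t.
  move=> h; have -> : 2 * t = t^-1 ^+ 2 * (2 * k) by rewrite /k; field.
  by rewrite ler_wpM2l // sqr_ge0.
have a1 : schur_le (fun p q => \sum_t xi p t * (eta q t - (xi q t)^*)) (2 * t).
  apply: (@schur_gram _ _ _ _ _ _ t^-1) => [|p|q]; first by rewrite invr_gt0.
    exact: big_s.
  apply: small_s; rewrite -nrm_conj; apply: le_trans (nd q).
  rewrite le_eqVlt; apply/orP; left; apply/eqP; apply: eq_bigr => i _.
  by rewrite -sqmodN; congr sqmod; rewrite rmorphB /= conjcK opprB.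
have a2 : schur_le (fun p q => \sum_t xi p t * (xi q t - xh q t)^*) (2 * t).
  apply: (@schur_gram _ _ _ _ _ _ t^-1) => [|p|q]; first by rewrite invr_gt0.
    exact: big_s.
  by apply: small_s; rewrite nrm_conj; apply: le_trans (nxd q) _; lra.
have a3 : schur_le (fun p q => \sum_t (xi p t - xh p t) * (xh q t)^*) (2 * t).
  apply: (@schur_gram _ _ _ _ _ _ t) => [//|p|q].
    by apply: le_trans (nxd p) _; rewrite k3; nra.
  by rewrite nrm_conj nxh; nra.
apply: schur_mono (schur_ext _ (schur_add a1 (schur_add a2 a3))); first by lra.
move=> p q; rewrite -!big_split -sumrB; apply: eq_bigr => i _ /=.
by rewrite rmorphB /=; ring.
Qed.

(** * Completely bounded multipliers and Schur kernels *)

Definition quot_ker (C : Type) (G : groupType) (phi : G -> C) (x y : G) : C :=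
  phi (monoid.mul (monoid.inv x) y).

Section OperatorNorm.
Variables (R : realType) (I J : finType).
Local Notation CC := R[i].

Definition mxact (M : I -> J -> CC) (a : J -> CC) (i : I) : CC := \sum_j M i j * a j.

Lemma formE b (M : I -> J -> CC) a : form b M a = \sum_i b i * mxact M a i.
Proof.
by apply: eq_bigr => i _; rewrite /mxact mulr_sumr; apply: eq_bigr => j _; rewrite mulrA.
Qed.

(** The form detects the norm at [b] proportional to the conjugate of [M a], with the optimal factor
    [c^-1]; the converse balances the two vectors by the square root of [c]. Both scalings require
    [c != 0]. *)
Lemma form_leP (M : I -> J -> CC) (c : R) : 0 <= c ->
  form_le M c <-> (forall a, nrm (mxact M a) <= c ^+ 2 * nrm a).
Proof.
move=> c0; split=> h a.
- pose b (t : R) i := toC t * (mxact M a i)^*.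
  have hb t : nrm (b t) = t ^+ 2 * nrm (mxact M a).
    by rewrite /nrm mulr_sumr; apply: eq_bigr => i _; rewrite sqmodM sqmod_toC sqmod_conj.
  have hf t : Rp (form (b t) M a) = t * nrm (mxact M a).
    rewrite formE Re_sum /nrm mulr_sumr; apply: eq_bigr => i _.
    by rewrite /b -mulrA Re_toCM mulrC [(_)^* * _]mulrC Re_mul_conj mulrC.
  have key t : 2 * (t * nrm (mxact M a)) <= c * (t ^+ 2 * nrm (mxact M a) + nrm a).
    by rewrite -hf -hb.
  have n0 := nrm_ge0 (mxact M a).
  have [c1|c1] := eqVneq c 0.
    by have := key 1; rewrite c1 expr0n /= !mul0r mul1r; lra.
  have cp : 0 < c by rewrite lt_neqAle eq_sym c1.
  have := key c^-1; rewrite [X in _ <= X](_ : _ = c^-1 * nrm (mxact M a) + c * nrm a); last by field.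
  move=> h2; have h3 : c^-1 * nrm (mxact M a) <= c * nrm a by lra.
  by rewrite expr2 -mulrA -ler_pdivrMl.
- move=> a'; rewrite formE Re_sum mulr_sumr.
  have [c1|c1] := eqVneq c 0.
    have z : nrm (mxact M a') <= 0 by have := h a'; rewrite c1 expr0n /= mul0r.
    rewrite c1 mul0r big1 // => i _.
    have -> : mxact M a' i = 0; last by rewrite mulr0 /= mulr0.
    apply: sqmod_eq0; apply: le_trans z; rewrite /nrm (bigD1 i) //= lerDl.
    by apply: sumr_ge0 => k _; exact: sqmod_ge0.
  have cp : 0 < c by rewrite lt_neqAle eq_sym c1.
  pose s := Num.sqrt c.
  have s2 : s ^+ 2 = c by rewrite sqr_sqrtr.
  have s0 : s != 0 by rewrite gt_eqF // sqrtr_gt0.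
  apply: (@le_trans _ _ (\sum_i (c * sqmod (a i) + c^-1 * sqmod (mxact M a' i)))).
    apply: ler_sum => i _.
    have -> : a i * mxact M a' i = (toC s * a i) * (toC s^-1 * mxact M a' i).
      have e : toC s * toC s^-1 = 1.
        by apply/eqP; rewrite eq_complex /= !mulr0 mul0r addr0 subr0 divff // !eqxx.
      by rewrite mulrACA e mul1r.
    apply: le_trans (Re_mul_le _ _) _.
    by rewrite !sqmodM !sqmod_toC exprVn s2.
  rewrite big_split -!mulr_sumr -!/(nrm _) mulrDr lerD2l /=.
  rewrite ler_pdivrMl //; apply: le_trans (h a') _.
  by rewrite expr2 mulrA.
Qed.

End OperatorNorm.

Section SeqSums.
Variables (R : realType) (T : eqType).

Lemma sum_le_support (F : T -> R) (s1 s2 : seq T) : (forall x, 0 <= F x) -> uniq s1 ->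
  (forall x, x \in s1 -> F x != 0 -> x \in s2) ->
  \sum_(x <- s1) F x <= \sum_(x <- s2) F x.
Proof.
move=> F0; elim: s1 s2 => [|x s1 IH] s2 /= u1 h.
  by rewrite big_nil; apply: sumr_ge0.
case/andP: u1 => xs1 u1; rewrite big_cons; have [Fx|Fx] := eqVneq (F x) 0.
  by rewrite Fx add0r; apply: IH => // y ys; apply: h; rewrite inE ys orbT.
have xs2 : x \in s2 by apply: h; rewrite // mem_head.
rewrite (big_rem x xs2) /= lerD2l; apply: IH => // y ys Fy.
have ys2 : y \in s2 by apply: h; rewrite // inE ys orbT.
have := perm_mem (perm_to_rem xs2) y; rewrite ys2 inE => /esym/orP[/eqP yx|//].
by rewrite -yx ys in xs1.
Qed.

Lemma sum_pick (V : pzSemiRingType) (F : T -> V) (s : seq T) z : uniq s ->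
  (z \notin s -> F z = 0) -> \sum_(x <- s) (x == z)%:R * F x = F z.
Proof.
move=> us h; have [zs|zs] := boolP (z \in s).
  rewrite (bigD1_seq z) //= eqxx mul1r big1 ?addr0 // => x /negPf ->.
  by rewrite mul0r.
rewrite h // big_seq big1 // => x xs; case: eqP => [xz|_]; last by rewrite mul0r.
by rewrite -xz xs in zs.
Qed.

End SeqSums.

Lemma sum_seq_sub (V : nmodType) (T : choiceType) (s : seq T) (F : T -> V) : uniq s ->
  \sum_(x : seq_sub s) F (ssval x) = \sum_(x <- s) F x.
Proof.
move=> us; rewrite -(big_map (@ssval T s) xpredT F); apply: perm_big.
apply: uniq_perm => //.
  by rewrite map_inj_uniq ?index_enum_uniq //; exact: val_inj.
move=> x; apply/mapP/idP => [[y _ ->]|xs]; first exact: ssvalP.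
by exists (SeqSub xs); rewrite ?mem_index_enum.
Qed.

Lemma sum_enum_val (V : nmodType) (T : finType) (F : T -> V) :
  \sum_(p < #|T|) F (enum_val p) = \sum_t F t.
Proof.
rewrite [RHS](reindex (@enum_val T T)) //=.
exists (@enum_rank T) => t _; [exact: enum_valK|exact: enum_rankK].
Qed.

Lemma modsq_sqmod (z : CC) : modsq z = sqmod z.
Proof. by []. Qed.

Section Transfer.
Variable G : groupType.

Section Rectangular.
Variables (I J : finType) (x : I -> G) (y : J -> G).
Local Notation T := (I + J)%type.
Local Notation N := #|{: T}|.

(** [M] multiplied on both sides by diagonal unitaries of group elements and placed as an
    off-diagonal block of a square matrix. The norm is unchanged, while [mult_mat phi] multiplies
    the entry at [i], [j] by [phi (x_i^-1 y_j)]. *)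
Definition rectX (M : I -> J -> CC) (p q : 'I_N) (g : G) : CC :=
  match enum_val p, enum_val q with
  | inl i, inr j => (g == mulg (invg (x i)) (y j))%:R * M i j
  | _, _ => 0
  end.

Definition rect_supp : seq G :=
  undup [seq mulg (invg (x i)) (y j) | i <- enum I, j <- enum J].

Lemma rect_suppP i j : mulg (invg (x i)) (y j) \in rect_supp.
Proof. by rewrite mem_undup; apply/allpairsP; exists (i, j); rewrite !mem_enum. Qed.

Lemma rectX_apply M xi p h : mat_apply rect_supp (rectX M) xi p h =
  if enum_val p is inl i then
    \sum_j M i j * xi (enum_rank (inr j)) (mulg (invg (y j)) (mulg (x i) h)) else 0.
Proof.
rewrite /mat_apply.
have -> : \sum_(q < N) \sum_(g <- rect_supp) rectX M p q g * xi q (mulg (invg g) h) =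
   \sum_(t : T) \sum_(g <- rect_supp) rectX M p (enum_rank t) g *
       xi (enum_rank t) (mulg (invg g) h).
  rewrite -[RHS](sum_enum_val (fun t : T => \sum_(g <- rect_supp) rectX M p (enum_rank t) g *
       xi (enum_rank t) (mulg (invg g) h))).
  by apply: eq_bigr => q _; rewrite enum_valK.
rewrite big_sumType /= [X in X + _]big1 ?add0r; last first.
  move=> i _; apply: big1 => g _; rewrite /rectX enum_rankK.
  by case: (enum_val p) => _; rewrite mul0r.
rewrite /rectX; case: (enum_val p) => [i|j'].
  apply: eq_bigr => j _; rewrite enum_rankK.
  rewrite (eq_bigr (fun g => (g == mulg (invg (x i)) (y j))%:R *
    (M i j * xi (enum_rank (inr j)) (mulg (invg g) h)))); last first.
    by move=> g _; rewrite mulrA.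
  rewrite sum_pick ?undup_uniq ?rect_suppP //.
  by rewrite monoid.invgM monoid.invgK -monoid.mulgA.
by apply: big1 => j _; apply: big1 => g _; rewrite mul0r.
Qed.

Lemma rectX_bound M c : 0 <= c -> form_le M c -> op_norm_le rect_supp (rectX M) c.
Proof.
move=> c0 /(form_leP _ c0) hM xi u hu t ut.
(* In the coordinate [k = x_i h] the operator is [M] acting on each fibre over [k]. The set [K]
   contains the translates for all [i], so that the sums can be exchanged. *)
pose eta j k := xi (enum_rank (inr j : T)) (mulg (invg (y j)) k).
pose K := undup [seq mulg (x i) h | i <- enum I, h <- t].
have nn (z : CC) : 0 <= sqmod z by exact: sqmod_ge0.
have -> : l2sq_on t (mat_apply rect_supp (rectX M) xi) =
    \sum_i \sum_(h <- t) sqmod (mxact M (eta^~ (mulg (x i) h)) i).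
  rewrite /l2sq_on.
  pose F0 (tt : T) : RR := \sum_(h <- t) (if tt is inl i then
     sqmod (mxact M (eta^~ (mulg (x i) h)) i) else 0).
  transitivity (\sum_(p < N) F0 (enum_val p)).
    apply: eq_bigr => p _; apply: eq_bigr => h _; rewrite rectX_apply modsq_sqmod.
    by case: (enum_val p) => // _; rewrite sqmod0.
  rewrite (sum_enum_val F0) /F0 big_sumType /= [X in _ + X]big1 ?addr0 // => j _.
  by rewrite big1.
apply: (@le_trans _ _ (\sum_i \sum_(k <- K) sqmod (mxact M (eta^~ k) i))).
  apply: ler_sum => i _.
  rewrite -(big_map (mulg (x i)) xpredT (fun k => sqmod (mxact M (eta^~ k) i))).
  apply: sum_le_support => //; first by rewrite map_inj_uniq //; exact: monoid.mulgI.
  move=> k /mapP[h ht ->] _; rewrite mem_undup; apply/allpairsP; exists (i, h).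
  by rewrite mem_enum.
rewrite exchange_big /=.
apply: (@le_trans _ _ (\sum_(k <- K) c ^+ 2 * nrm (eta^~ k))).
  by apply: ler_sum => k _; exact: hM.
rewrite -mulr_sumr ler_wpM2l ?sqr_ge0 // /nrm exchange_big /=.
apply: (@le_trans _ _ (\sum_j \sum_(h <- u) sqmod (xi (enum_rank (inr j : T)) h))).
  apply: ler_sum => j _; rewrite /eta.
  rewrite -(big_map (mulg (invg (y j))) xpredT (fun k => sqmod (xi (enum_rank (inr j : T)) k))).
  apply: sum_le_support => //.
    by rewrite map_inj_uniq ?undup_uniq //; exact: monoid.mulgI.
  move=> k _; apply: contraNT => ku; have [_ ->] := hu (enum_rank (inr j : T)); last exact: ku.
  by rewrite sqmod0.
rewrite /l2sq_on.
pose F0 (tt : T) : RR := \sum_(h <- u) sqmod (xi (enum_rank tt) h).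
have -> : \sum_(p < N) \sum_(h <- u) modsq (xi p h) = \sum_(p < N) F0 (enum_val p).
  by apply: eq_bigr => p _; rewrite /F0 enum_valK.
rewrite (sum_enum_val F0) /F0 big_sumType /= lerDr; apply: sumr_ge0 => i _; exact: sumr_ge0.
Qed.

Lemma rectX_lower M c : 0 <= c -> op_norm_le rect_supp (rectX M) c -> form_le M c.
Proof.
move=> c0 h; apply/(form_leP _ c0) => a.
(* The coefficient [a j] sits at [y_j^-1]; all of them meet in row [i] at the point [x_i^-1]. *)
pose xi (q : 'I_N) (g : G) : CC :=
  if enum_val q is inr j then (g == invg (y j))%:R * a j else 0.
pose u := undup [seq invg (y j) | j <- enum J].
pose t := undup [seq invg (x i) | i <- enum I].
have yu j : invg (y j) \in u by rewrite mem_undup; apply/mapP; exists j; rewrite ?mem_enum.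
have hu q : supported_on u (xi q).
  split; first exact: undup_uniq.
  move=> g; rewrite /xi; case: (enum_val q) => // j; case: eqP => [->|_ _]; last by rewrite mul0r.
  by rewrite yu.
have := h xi u hu t (undup_uniq _).
have -> : l2sq_on u xi = nrm a.
  rewrite /l2sq_on.
  pose F0 (tt : T) : RR := if tt is inr j then sqmod (a j) else 0.
  transitivity (\sum_(p < N) F0 (enum_val p)); last first.
    by rewrite (sum_enum_val F0) /F0 big_sumType /= big1 ?add0r.
  apply: eq_bigr => q _; rewrite /xi /F0; case: (enum_val q) => [i|j].
    by apply: big1 => g _; rewrite modsq_sqmod sqmod0.
  rewrite (eq_bigr (fun g => (g == invg (y j))%:R * sqmod (a j))).
    by rewrite sum_pick ?undup_uniq ?yu.
  move=> g _; rewrite modsq_sqmod sqmodM; congr (_ * _).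
  by case: eqP => _; rewrite ?sqmod1 ?sqmod0.
apply: le_trans.
rewrite /l2sq_on.
pose F0 (tt : T) : RR := \sum_(g <- t) sqmod (mat_apply rect_supp (rectX M) xi (enum_rank tt) g).
have -> : \sum_(p < N) \sum_(g <- t) modsq (mat_apply rect_supp (rectX M) xi p g)
   = \sum_(p < N) F0 (enum_val p).
  by apply: eq_bigr => p _; rewrite /F0 enum_valK.
rewrite (sum_enum_val F0) /F0 big_sumType /= -[leLHS]addr0 lerD //; last first.
  by apply: sumr_ge0 => j _; apply: sumr_ge0 => g _; exact: sqmod_ge0.
apply: ler_sum => i _.
have xt : invg (x i) \in t by rewrite mem_undup; apply/mapP; exists i; rewrite ?mem_enum.
rewrite (bigD1_seq _ xt (undup_uniq _)) /= rectX_apply enum_rankK.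
have -> : \sum_j M i j * xi (enum_rank (inr j : T)) (mulg (invg (y j)) (mulg (x i) (invg (x i))))
    = mxact M a i.
  apply: eq_bigr => j _; rewrite /xi enum_rankK monoid.mulgV monoid.mulg1 eqxx.
  by rewrite mul1r.
by rewrite lerDl; apply: sumr_ge0 => g _; exact: sqmod_ge0.
Qed.

End Rectangular.

Lemma schur_of_cb (phi : G -> CC) (C : RR) : 0 <= C -> cb_norm_le phi C ->
  schur_le (quot_ker phi) C.
Proof.
move=> C0 h I J x y M c c0 hM.
apply: (@rectX_lower I J x y); first exact: mulr_ge0.
have -> : rectX x y (fun i j => quot_ker phi (x i) (y j) * M i j) =
    mult_mat phi (rectX x y M).
  apply: funext => p; apply: funext => q; apply: funext => g; rewrite /rectX /mult_mat.
  case: (enum_val p) => [i|i]; last by rewrite mulr0.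
  case: (enum_val q) => [j|j]; first by rewrite mulr0.
  by case: eqP => [->|_]; rewrite ?mul0r ?mulr0 ?mul1r.
apply: h => //; last exact: rectX_bound.
move=> p q; split=> [|g]; first exact: undup_uniq.
rewrite /rectX; case: (enum_val p) => // i; case: (enum_val q) => // j.
by case: eqP => [->|_ _]; rewrite ?mul0r // rect_suppP.
Qed.

Lemma conv_sum (f xi : G -> CC) (s u : seq G) h : supported_on s f -> supported_on u xi ->
  \sum_(g <- s) f g * xi (mulg (invg g) h) = \sum_(k <- u) f (mulg h (invg k)) * xi k.
Proof.
move=> [us fs] [uu xu].
transitivity (\sum_(g <- s) \sum_(k <- u) (k == mulg (invg g) h)%:R * (f g * xi k)).
  apply: eq_bigr => g _; rewrite (sum_pick (F := fun k => f g * xi k)) // => hk.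
  by rewrite xu // mulr0.
rewrite exchange_big /=; apply: eq_bigr => k _.
transitivity (\sum_(g <- s) (g == mulg h (invg k))%:R * (f g * xi k)).
  apply: eq_bigr => g _; congr (_%:R * _); congr nat_of_bool; apply/eqP/eqP => [->|->].
    by rewrite monoid.invgM monoid.invgK monoid.mulgA monoid.mulgV monoid.mul1g.
  by rewrite monoid.invgM monoid.invgK -monoid.mulgA monoid.mulVg monoid.mulg1.
rewrite (sum_pick (F := fun g => f g * xi k)) // => hg.
by rewrite fs // mul0r.
Qed.

(** Cut down to the finite windows [t] and [u], the operator is a scalar matrix with entries
    [X i j (h k^-1)], and [phi (h k^-1)] is the kernel at the inverse points [h^-1] and [k^-1]. *)
Lemma cb_of_schur (phi : G -> CC) (C : RR) : 0 <= C ->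
  schur_le (quot_ker phi) C -> cb_norm_le phi C.
Proof.
move=> C0 hphi n s X c hX c0 h xi u hu t ut.
(* For [n = 0] the support condition on [xi] is void and gives no information on [u]. *)
have [uu|] := boolP (uniq u); last first.
  case: n X hX h xi hu => [|n] X hX h xi hu; last by have [->] := hu ord0.
  by rewrite /l2sq_on !big_ord0 mulr0.
pose I : finType := ('I_n * seq_sub t)%type; pose J : finType := ('I_n * seq_sub u)%type.
pose M (p : I) (q : J) : CC := X p.1 q.1 (mulg (ssval p.2) (invg (ssval q.2))).
have hsum (Y : 'I_n -> 'I_n -> G -> CC) (zeta : 'I_n -> G -> CC) :
    (forall i j, supported_on s (Y i j)) -> (forall j, supported_on u (zeta j)) ->
    l2sq_on t (mat_apply s Y zeta) =
    nrm (mxact (fun (p : I) (q : J) => Y p.1 q.1 (mulg (ssval p.2) (invg (ssval q.2))))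
       (fun q => zeta q.1 (ssval q.2))).
  move=> hY hz; rewrite /l2sq_on /nrm.
  rewrite -(pair_big xpredT xpredT (fun (i : 'I_n) (hh : seq_sub t) => sqmod (mxact
     (fun (p : I) (q : J) => Y p.1 q.1 (mulg (ssval p.2) (invg (ssval q.2))))
       (fun q => zeta q.1 (ssval q.2)) (i, hh)))) /=.
  apply: eq_bigr => i _; rewrite -(sum_seq_sub _ ut); apply: eq_bigr => hh _.
  rewrite modsq_sqmod; congr sqmod; rewrite /mat_apply /mxact.
  rewrite -(pair_big xpredT xpredT (fun (j : 'I_n) (k : seq_sub u) =>
     Y i j (mulg (ssval hh) (invg (ssval k))) * zeta j (ssval k))) /=.
  apply: eq_bigr => j _; rewrite (conv_sum _ (hY i j) (hz j)).
  by rewrite -(sum_seq_sub (fun k => Y i j (mulg (ssval hh) (invg k)) * zeta j k) uu).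
have hnrm (zeta : 'I_n -> G -> CC) : l2sq_on u zeta = nrm (fun q : J => zeta q.1 (ssval q.2)).
  rewrite /l2sq_on /nrm.
  rewrite -(pair_big xpredT xpredT (fun (i : 'I_n) (k : seq_sub u) => sqmod (zeta i (ssval k)))) /=.
  by apply: eq_bigr => i _; rewrite -(sum_seq_sub _ uu).
have hM : form_le M c.
  apply/(form_leP _ c0) => a.
  pose zeta (j : 'I_n) (k : G) : CC := if insub k is Some k' then a (j, k') else 0.
  have za : (fun q : J => zeta q.1 (ssval q.2)) = a.
    apply: funext => -[j k]; rewrite /zeta /= -[ssval k]/(val k) valK.
    by [].
  have hz j : supported_on u (zeta j).
    by split=> // g gu; rewrite /zeta insubN.
  by have := h zeta u hz t ut; rewrite hsum // hnrm za.
have := hphi I J (fun p => invg (ssval p.2)) (fun q => invg (ssval q.2)) M c c0 hM.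
move=> /(form_leP _ (mulr_ge0 C0 c0)) /(_ (fun q => xi q.1 (ssval q.2))).
rewrite -hnrm; apply: le_trans.
have hY i j : supported_on s (mult_mat phi X i j).
  have [us xs] := hX i j; split=> // g gs; by rewrite /mult_mat xs // mulr0.
rewrite hsum // le_eqVlt; apply/orP; left; apply/eqP; congr nrm; apply: funext => p.
apply: eq_bigr => q _; rewrite /mult_mat /quot_ker monoid.invgK.
by [].
Qed.

End Transfer.

(** * Kernels on words *)

Section Words.
Variables (R : realType) (L : eqType) (D : Type) (pi : L -> D) (e : D) (side : L -> bool).
Local Notation CC := R[i].
Implicit Types (f : D -> D -> CC) (x y : seq L) (i j : nat).

Definition tailL f x : CC := \prod_(l <- x) f (pi l) e.
Definition tailR f y : CC := \prod_(l <- y) f e (pi l).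

(** In the cosets met by the common prefix both words have the same coordinate. Beyond the branching
    point each coset is entered by one word only, and the other one stays at the base point [e]. *)
Fixpoint wker f x y : CC :=
  match x, y with
  | a :: x', b :: y' =>
      if a == b then wker f x' y' else f (pi a) (pi b) * (tailL f x' * tailR f y')
  | _, _ => tailL f x * tailR f y
  end.

(** The reduced length of [x^-1 y]: distinct branching letters on the same side merge into one. *)
Fixpoint gap x y : nat :=
  match x, y with
  | a :: x', b :: y' =>
      if a == b then gap x' y'
      else if side a == side b then (size x' + size y').+1 else size x + size y
  | _, _ => size x + size y
  end.

Lemma wker0l f y : wker f [::] y = tailR f y.
Proof. by rewrite /= /tailL big_nil mul1r. Qed.

Lemma wker0r f x : wker f x [::] = tailL f x.
Proof. by case: x => [|a x] /=; rewrite /tailR big_nil mulr1. Qed.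

Lemma wker00 f : wker f [::] [::] = 1.
Proof. by rewrite wker0l /tailR big_nil. Qed.

Lemma wker_cons f a x b y : wker f (a :: x) (b :: y) =
  if a == b then wker f x y else f (pi a) (pi b) * (tailL f x * tailR f y).
Proof. by []. Qed.

Arguments wker : simpl never.

Definition hd_of x : D := if x is a :: _ then pi a else e.
Definition strip (h : L) x : seq L := if x is a :: x' then (if a == h then x' else [::]) else [::].

(** Equal first letters leave a single nonempty factor. Distinct ones leave two, in each of which
    the other word is empty; these are the two tails. All other factors compare empty words. *)
Lemma wker_strip f (H : seq L) x y : (forall p, f p p = 1) -> uniq H ->
  {subset take 1 x <= H} -> {subset take 1 y <= H} ->
  wker f x y = f (hd_of x) (hd_of y) * \prod_(h <- H) wker f (strip h x) (strip h y).
Proof.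
move=> f1 uH.
have aH a w : {subset take 1 (a :: w) <= H} -> a \in H.
  by apply; rewrite /= mem_head.
case: x => [|a x]; case: y => [|b y] hx hy.
- by rewrite f1 mul1r big1 ?wker00 // => h _; rewrite wker00.
- rewrite (bigD1_seq b) ?(aH _ _ hy) //= eqxx big1 ?mulr1 => [|h /negPf hb].
    by rewrite !wker0l /tailR big_cons.
  by rewrite eq_sym hb wker00.
- rewrite (bigD1_seq a) ?(aH _ _ hx) //= eqxx big1 ?mulr1 => [|h /negPf hb].
    by rewrite !wker0r /tailL big_cons.
  by rewrite eq_sym hb wker00.
- rewrite (bigD1_seq a) ?(aH _ _ hx) //= wker_cons eqxx; have [<-|ab] := eqVneq a b.
    rewrite f1 !mul1r big1 ?mulr1 // => h /negPf ha.
    by rewrite eq_sym ha wker00.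
  rewrite wker0r -big_filter (bigD1_seq b) ?filter_uniq //=; last first.
    by rewrite mem_filter eq_sym ab (aH _ _ hy).
  rewrite eqxx (negPf ab) wker0l big_seq_cond big1 ?mulr1 // => h.
  rewrite mem_filter => /andP[/andP[ha _] hb].
  by rewrite eq_sym (negPf ha) eq_sym (negPf hb) wker00.
Qed.

(* By induction on the length: the kernel is that of the first letters times, over all letters h,
   the same kernel on the words with their first letter h removed ([::] if they start otherwise). *)
Lemma schur_wker f : (forall p, f p p = 1) -> schur_le f 1 -> schur_le (wker f) 1.
Proof.
move=> f1 hf.
have h n : schur_le (fun x y => wker f (take n x) (take n y)) 1.
  elim: n => [|n IH].
    by apply: (schur_ext _ (@schur_1 R (seq L))) => x y; rewrite !take0 wker00.
  apply: schur_local => s.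
  pose H := undup (flatten s).
  exists (fun x y => f (hd_of x) (hd_of y) *
     \prod_(h <- H) wker f (take n (strip h x)) (take n (strip h y))).
    rewrite -[X in schur_le _ X]mulr1; apply: schur_mul => //; first exact: schur_pull.
    (* The number of factors depends on [s], so only the constant 1 passes through the induction. *)
    rewrite -[X in schur_le _ X](expr1n _ (size H)); apply: schur_prod => // h.
    exact: (schur_pull (strip h) (strip h) IH).
  have sub x : x \in s -> {subset take 1 (take n.+1 x) <= H}.
    move=> xs l; rewrite mem_undup => hl; apply/flattenP; exists x => //.
    by apply: (mem_take (n0 := n.+1)); apply: (mem_take (n0 := 1%N)).
  move=> x y xs ys; rewrite (wker_strip f1 (undup_uniq _) (sub _ xs) (sub _ ys)).
  congr (f _ _ * _); [by case: (x)|by case: (y)|].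
  have es h w : strip h (take n.+1 w) = take n (strip h w).
    by case: w => //= a w; case: ifP.
  by apply: eq_bigr => h _; rewrite !es.
apply: schur_local => s; exists (fun x y =>
   wker f (take (\max_(x <- s) size x) x) (take (\max_(x <- s) size x) y)) => //.
have le x : x \in s -> (size x <= \max_(x <- s) size x)%N.
  by move=> xs; apply: (@leq_bigmax_seq _ s xpredT).
by move=> x y xs ys; rewrite !take_oversize ?le.
Qed.

Definition slot := ((seq L -> D) * (seq L -> D))%type.
(** Counting from the end makes the positions of the letters after a common prefix independent of
    that prefix. *)
Definition nthR i x : D := nth e (map pi (rev x)) i.
Definition slots i j : seq slot :=
  [seq (nthR l, fun=> e) | l <- iota 0 i] ++ [seq ((fun=> e), nthR l) | l <- iota 0 j].
Definition slotker f (s : seq slot) x y : CC := \prod_(p <- s) f (p.1 x) (p.2 y).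

Definition sideR i x : bool := nth false (map side (rev x)) i.

(* The longest common prefix leaves i letters of x and j letters of y, which do not
   start on the same side. *)
Definition apart i j x y : bool :=
  [&& (i <= size x)%N, (j <= size y)%N, drop i (rev x) == drop j (rev y) &
      ~~ [&& (0 < i)%N, (0 < j)%N & sideR i.-1 x == sideR j.-1 y]].

(* The longest common prefix leaves i.+1 letters of x and j.+1 letters of y, which start with
   distinct letters on the same side. *)
Definition clash i j x y : bool :=
  [&& (i < size x)%N, (j < size y)%N, drop i.+1 (rev x) == drop j.+1 (rev y),
      sideR i x == sideR j y & onth (rev x) i != onth (rev y) j].

(** At a clash [i.+1] and [j.+1] letters remain and two of them merge, hence the weight at
    [(i + j).+1]; the extra slot compares these two letters. *)
Definition term f (g : nat -> CC) i j x y : CC :=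
  g (i + j)%N * ((apart i j x y)%:R * slotker f (slots i j) x y) +
  g (i + j).+1 * ((clash i j x y)%:R * slotker f ((nthR i, nthR j) :: slots i j) x y).

Definition expansion f (g : nat -> CC) N x y : CC :=
  \sum_(i < N) \sum_(j < N) term f g i j x y.

Lemma size_slots i j : size (slots i j) = (i + j)%N.
Proof. by rewrite size_cat !size_map !size_iota. Qed.

Lemma tailL_nthR f x : \prod_(l <- iota 0 (size x)) f (nthR l x) e = tailL f x.
Proof.
have -> : tailL f x = \prod_(p <- map pi (rev x)) f p e.
  by rewrite big_map /tailL; apply: perm_big; rewrite perm_sym perm_rev.
by rewrite (big_nth e) size_map size_rev /index_iota subn0.
Qed.

Lemma tailR_nthR f x : \prod_(l <- iota 0 (size x)) f e (nthR l x) = tailR f x.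
Proof.
have -> : tailR f x = \prod_(p <- map pi (rev x)) f e p.
  by rewrite big_map /tailR; apply: perm_big; rewrite perm_sym perm_rev.
by rewrite (big_nth e) size_map size_rev /index_iota subn0.
Qed.

Lemma slotker_slots f i j x y : slotker f (slots i j) x y =
  \prod_(l <- iota 0 i) f (nthR l x) e * \prod_(l <- iota 0 j) f e (nthR l y).
Proof. by rewrite /slotker big_cat !big_map. Qed.

Lemma slotker_size f x y : slotker f (slots (size x) (size y)) x y = tailL f x * tailR f y.
Proof. by rewrite slotker_slots tailL_nthR tailR_nthR. Qed.

Lemma nthR_cons i a x : nthR i (a :: x) = if (i < size x)%N then nthR i x else
   if i == size x then pi a else e.
Proof. by rewrite /nthR rev_cons map_rcons nth_rcons size_map size_rev. Qed.

Lemma sideR_cons i a x : sideR i (a :: x) = if (i < size x)%N then sideR i x else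
   if i == size x then side a else false.
Proof. by rewrite /sideR rev_cons map_rcons nth_rcons size_map size_rev. Qed.

Lemma onthR_cons i a x : onth (rev (a :: x)) i = if (i < size x)%N then onth (rev x) i else
   if i == size x then Some a else None.
Proof. by rewrite rev_cons !onthE map_rcons nth_rcons size_map size_rev. Qed.

Lemma dropR_cons i a x : (i <= size x)%N -> drop i (rev (a :: x)) = rcons (drop i (rev x)) a.
Proof. by move=> h; rewrite rev_cons drop_rcons // size_rev. Qed.

Lemma dropR_full x : drop (size x) (rev x) = [::].
Proof. by rewrite drop_oversize // size_rev. Qed.

Lemma rcons_eq0 (T : eqType) (s : seq T) a : (rcons s a == [::]) = false.
Proof. by case: s. Qed.

Lemma apart_consE i j a x y : apart i j (a :: x) (a :: y) = apart i j x y.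
Proof.
rewrite /apart /=; have [ix|ix|->] := ltngtP i (size x).+1.
- rewrite ltnS in ix; rewrite ix /=; have [jy|jy|->] := ltngtP j (size y).+1.
  + rewrite ltnS in jy; rewrite jy !dropR_cons // eqseq_rcons eqxx andbT.
    congr (_ && _); case: i ix => [|i] ix //=; case: j jy => [|j] jy //=.
    by rewrite !sideR_cons ix jy.
  + have h1 : (j <= (size y).+1)%N = false by lia.
    have h2 : (j <= size y)%N = false by lia.
    by rewrite ?h1 ?h2 ?andbF.
  + rewrite ltnn -[(size y).+1]/(size (a :: y)) dropR_full dropR_cons // rcons_eq0.
    by rewrite andbF.
- have h1 : (i <= (size x).+1)%N = false by lia.
  have h2 : (i <= size x)%N = false by lia.
    by rewrite ?h1 ?h2 ?andbF.
- rewrite ltnn /= -[(size x).+1]/(size (a :: x)) dropR_full ?leqnn /=.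
  have [jy|jy|->] := ltngtP j (size y).+1.
  + by rewrite dropR_cons // eq_sym rcons_eq0 !andbF.
  + by rewrite ?andbF.
  + by rewrite !sideR_cons /= !ltnn !eqxx !andbF.
Qed.

Lemma clash_consE i j a x y : clash i j (a :: x) (a :: y) = clash i j x y.
Proof.
rewrite /clash /=; have [ix|ix|->] := ltngtP i (size x).
- have [jy|jy|->] := ltngtP j (size y).
  + rewrite !ltnS (ltnW ix) (ltnW jy) !dropR_cons // eqseq_rcons eqxx andbT /=.
    by rewrite !sideR_cons !onthR_cons ix jy.
  + by rewrite !ltnS (_ : (j <= size y)%N = false) ?andbF //; lia.
  + rewrite -[(size y).+1]/(size (a :: y)) dropR_full dropR_cons // rcons_eq0.
    by rewrite !andbF.
- by rewrite !ltnS (_ : (i <= size x)%N = false) ?andbF //; lia.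
- rewrite ltnS leqnn /= -[(size x).+1]/(size (a :: x)) dropR_full.
  have [jy|jy|->] := ltngtP j (size y).
  + by rewrite dropR_cons // eq_sym rcons_eq0 !andbF.
  + by rewrite !ltnS (_ : (j <= size y)%N = false) ?andbF //; lia.
  + by rewrite !onthR_cons !ltnn !eqxx !andbF.
Qed.

Lemma slotker_consE f i j a x b y : (i <= size x)%N -> (j <= size y)%N ->
  slotker f (slots i j) (a :: x) (b :: y) = slotker f (slots i j) x y.
Proof.
move=> ix jy; rewrite !slotker_slots; congr (_ * _);
  rewrite !big_seq; apply: eq_bigr => l; rewrite mem_iota /= add0n => hl.
- by rewrite nthR_cons (leq_trans hl ix).
- by rewrite nthR_cons (leq_trans hl jy).
Qed.

Lemma expansion_cons f g N a x y :
  expansion f g N (a :: x) (a :: y) = expansion f g N x y.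
Proof.
apply: eq_bigr => i _; apply: eq_bigr => j _; rewrite /term apart_consE clash_consE.
congr (_ * _ + _ * _).
- case ap: (apart _ _ _ _); last by rewrite !mul0r.
  by case/and4P: ap => ix jy _ _; rewrite slotker_consE.
- case ap: (clash _ _ _ _); last by rewrite !mul0r.
  case/and5P: ap => ix jy _ _ _; rewrite /slotker !big_cons /= -!/(slotker f _ _ _).
  by rewrite slotker_consE ?(ltnW ix) ?(ltnW jy) // !nthR_cons ix jy.
Qed.

Lemma sum2_single (F : nat -> nat -> CC) N i0 j0 : (i0 < N)%N -> (j0 < N)%N ->
  (forall i j, (i != i0) || (j != j0) -> F i j = 0) ->
  \sum_(i < N) \sum_(j < N) F i j = F i0 j0.
Proof.
move=> hi hj h; rewrite (bigD1 (Ordinal hi)) //= (bigD1 (Ordinal hj)) //= !big1 ?addr0 //.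
  by move=> i; rewrite -val_eqE /= => hne; apply: big1 => j _; apply: h; rewrite hne.
by move=> j; rewrite -val_eqE /= => hne; apply: h; rewrite hne orbT.
Qed.

(** Two words have one longest common prefix, so exactly one summand survives. Across different
    sides [f] splits through [e], and the branching letters fill ordinary slots. *)
Lemma expansionE f g N x y : f e e = 1 ->
  (forall a b, side a != side b -> f (pi a) (pi b) = f (pi a) e * f e (pi b)) ->
  (size x < N)%N -> (size y < N)%N ->
  expansion f g N x y = g (gap x y) * wker f x y.
Proof.
move=> fe fs; elim: x y => [|a x IH] y.
  move=> xN yN; rewrite wker0l /= add0n.
  rewrite /expansion (sum2_single (F := fun i j => term f g i j [::] y) (i0 := 0) (j0 := size y)) // => [|i j h].
    rewrite /term /apart /clash /= !leqnn dropR_full eqxx /= mul0r mulr0 addr0 add0n mul1r.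
    by rewrite slotker_slots big_nil mul1r tailR_nthR.
  rewrite /term; have -> : clash i j [::] y = false by [].
  have -> : apart i j [::] y = false.
    apply/negP => /and4P[]; rewrite leqn0 => /eqP i0 jy /eqP h3 _; move: h; rewrite i0 /=.
    move: h3; rewrite i0 /= => /(congr1 size) /=; rewrite size_drop size_rev.
    move=> /esym /eqP; rewrite subn_eq0 => yj; by rewrite eqn_leq jy yj.
  by rewrite /term !mul0r !mulr0 addr0.
case: y => [|b y].
  move=> xN yN; rewrite wker0r /= addn0.
  rewrite /expansion (sum2_single (F := fun i j => term f g i j (a :: x) [::]) (i0 := (size x).+1) (j0 := 0)) // => [|i j h].
    rewrite /term /apart /clash /= -[(size x).+1]/(size (a :: x)) !leqnn dropR_full eqxx /=.
    rewrite andbF mul0r mulr0 addr0 addn0 mul1r.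
    rewrite slotker_slots big_nil mulr1; congr (_ * _); exact: (tailL_nthR f (a :: x)).
  rewrite /term; have -> : clash i j (a :: x) [::] = false by rewrite /clash /= andbF.
  have -> : apart i j (a :: x) [::] = false.
    apply/negP => /and4P[ix]; rewrite leqn0 => /eqP j0 /eqP h3 _; move: h; rewrite j0 /=.
    rewrite orbF.
    move: h3; rewrite j0 /= => /(congr1 size) /=; rewrite size_drop size_rev.
    by move=> /eqP; rewrite subn_eq0 => xi; move: ix; rewrite eqn_leq /= xi andbT => ->.
  by rewrite /term !mul0r !mulr0 addr0.
have [<-|ab] := eqVneq a b.
  move=> xN yN; rewrite expansion_cons wker_cons /= eqxx IH //; exact: ltnW.
move=> /= xN yN; rewrite wker_cons (negPf ab).
(* With distinct first letters, the two prefixes can agree only if both are empty; this pins down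
   [i] and [j]. *)
have ne i j : drop i (rev (a :: x)) = drop j (rev (b :: y)) ->
    ((size x).+1 <= i)%N /\ ((size y).+1 <= j)%N.
  move=> h; have [ix|ix] := leqP i (size x); have [jy|jy] := leqP j (size y).
  - by move: h; rewrite !dropR_cons // => /eqP; rewrite eqseq_rcons (negPf ab) andbF.
  - by move: h; rewrite dropR_cons // (@drop_oversize _ j) ?size_rev // => /eqP; rewrite rcons_eq0.
  - move: h; rewrite (@dropR_cons j) // drop_oversize ?size_rev // => /esym/eqP.
    by rewrite rcons_eq0.
  - by [].
have [sab|sab] := eqVneq (side a) (side b).
- rewrite /expansion (sum2_single (F := fun i j => term f g i j (a :: x) (b :: y)) (i0 := size x) (j0 := size y)) ?(ltnW xN) ?(ltnW yN) //.
    rewrite /term; have -> : apart (size x) (size y) (a :: x) (b :: y) = false.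
      by apply/negP => /and4P[_ _ /eqP /ne []]; rewrite ltnn.
    have -> : clash (size x) (size y) (a :: x) (b :: y).
      rewrite /clash /= !ltnS !leqnn -[(size x).+1]/(size (a :: x)).
      rewrite -[(size y).+1]/(size (b :: y)) !dropR_full eqxx !sideR_cons !onthR_cons.
      by rewrite !ltnn !eqxx sab eqxx.
    rewrite /term mul0r mulr0 add0r mul1r /slotker big_cons -/(slotker f _ _ _) /=.
    by rewrite !nthR_cons !ltnn !eqxx slotker_consE // slotker_size.
  move=> i j h; rewrite /term.
  have -> : apart i j (a :: x) (b :: y) = false.
    apply/negP => /and4P[/= ix jy /eqP /ne [h1 h2] /negP]; apply.
    have -> : i = (size x).+1 by lia.
    have -> : j = (size y).+1 by lia.
    by rewrite /= !sideR_cons !ltnn !eqxx sab.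
  have -> : clash i j (a :: x) (b :: y) = false.
    apply/negP => /and5P[/= ix jy /eqP /ne [h1 h2] _ _]; move: h.
    by move=> /orP[]/eqP; lia.
  by rewrite /term !mul0r !mulr0 addr0.
- rewrite /expansion (sum2_single (F := fun i j => term f g i j (a :: x) (b :: y)) (i0 := (size x).+1) (j0 := (size y).+1)) //.
    rewrite /term; have -> : clash (size x).+1 (size y).+1 (a :: x) (b :: y) = false.
      by rewrite /clash /= ltnn.
    have -> : apart (size x).+1 (size y).+1 (a :: x) (b :: y).
      rewrite /apart /= !leqnn -[(size x).+1]/(size (a :: x)).
      rewrite -[(size y).+1]/(size (b :: y)) !dropR_full eqxx /= !sideR_cons !ltnn !eqxx.
      by rewrite (negPf sab).
    rewrite /term mul0r mulr0 addr0 mul1r -[(size x).+1]/(size (a :: x)).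
    rewrite -[(size y).+1]/(size (b :: y)) slotker_size fs // /tailL /tailR !big_cons.
    by congr (_ * _); ring.
  move=> i j h; rewrite /term.
  have -> : clash i j (a :: x) (b :: y) = false.
    apply/negP => /and5P[/= ix jy /eqP /ne [h1 h2]].
    have -> : i = size x by lia.
    have -> : j = size y by lia.
    by rewrite !sideR_cons !ltnn !eqxx (negPf sab).
  have -> : apart i j (a :: x) (b :: y) = false.
    apply/negP => /and4P[/= ix jy /eqP /ne [h1 h2] _]; move: h.
    by move=> /orP[]/eqP; lia.
  by rewrite /term !mul0r !mulr0 addr0.
Qed.

End Words.

(** * Norm bounds for the expansion of word kernels *)

Lemma schur_left (R : realType) (X : Type) (P : X -> bool) :
  schur_le (fun x _ => (P x)%:R : R[i]) 1.
Proof.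
apply: (schur_ext _ (schur_pull P (fun=> true) (@schur_delta R bool))) => x y.
by rewrite eqb_id.
Qed.

Lemma schur_right (R : realType) (X : Type) (P : X -> bool) :
  schur_le (fun _ y => (P y)%:R : R[i]) 1.
Proof.
apply: (schur_ext _ (schur_pull (fun=> true) P (@schur_delta R bool))) => x y.
by rewrite eq_sym eqb_id.
Qed.

Lemma schur_neg (R : realType) (X : Type) (b : X -> X -> bool) :
  schur_le (fun x y => (b x y)%:R : R[i]) 1 -> schur_le (fun x y => (~~ b x y)%:R : R[i]) 2.
Proof.
move=> h; have -> : 2 = 1 + 1 :> R by lra.
apply: (schur_ext _ (schur_sub (@schur_1 R X) h)) => x y.
by case: (b x y); rewrite /= ?subrr ?subr0.
Qed.

Section Estimates.
Variables (R : realType) (L : eqType) (D : Type) (pi : L -> D) (e : D) (side : L -> bool).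
Local Notation CC := R[i].
Implicit Types (f u v : D -> D -> CC) (x y : seq L) (i j : nat) (g : nat -> R).
Local Notation slotker := (@slotker R L D).
Local Notation wexp f g := (expansion pi e side f (fun n => toC (g n))).
Local Notation wker := (wker pi e).

(** Each clause concerns one word only or equates a function of [x] with a function of [y], so it is
    a pullback of [schur_delta]. Only the negated clause, 1 minus such a kernel, costs a factor
    2. *)
Lemma schur_apart i j : schur_le (fun x y => (apart side i j x y)%:R : CC) 2.
Proof.
have h1 := @schur_left R (seq L) (fun x => i <= size x)%N.
have h2 := @schur_right R (seq L) (fun x => j <= size x)%N.
have h3 := schur_pull (fun x : seq L => drop i (rev x)) (fun y => drop j (rev y))
  (@schur_delta R _).
have h4 : schur_le (fun x y : seq L =>
    (~~ [&& (0 < i)%N, (0 < j)%N & sideR side i.-1 x == sideR side j.-1 y])%:R : CC) 2.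
  apply: schur_neg; case: (0 < i)%N => /=; last by apply: schur_mono (@schur_0 R _); exact: ler01.
  case: (0 < j)%N => /=; last by apply: schur_mono (@schur_0 R _); exact: ler01.
  exact: (schur_pull (sideR side i.-1) (sideR side j.-1) (@schur_delta R _)).
have := schur_mul _ h1 (schur_mul _ h2 (schur_mul _ h3 h4)).
rewrite !mul1r => /(_ (ler0n _ _) (ler0n _ _) (ler0n _ _)).
by apply: schur_ext => x y; rewrite -!natrM !mulnb.
Qed.

Lemma schur_clash i j : schur_le (fun x y => (clash side i j x y)%:R : CC) 2.
Proof.
have h1 := @schur_left R (seq L) (fun x => i < size x)%N.
have h2 := @schur_right R (seq L) (fun x => j < size x)%N.
have h3 := schur_pull (fun x : seq L => drop i.+1 (rev x)) (fun y => drop j.+1 (rev y))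
  (@schur_delta R _).
have h4 := schur_pull (sideR side i) (sideR side j) (@schur_delta R _).
have h5 := schur_neg (schur_pull (fun x : seq L => onth (rev x) i)
  (fun y => onth (rev y) j) (@schur_delta R _)).
have := schur_mul _ h1 (schur_mul _ h2 (schur_mul _ h3 (schur_mul _ h4 h5))).
rewrite !mul1r => /(_ (ler0n _ _) (ler0n _ _) (ler0n _ _) (ler0n _ _)).
by apply: schur_ext => x y; rewrite -!natrM !mulnb.
Qed.

Lemma schur_slotker f (C : R) (s : seq (slot L D)) : 0 <= C -> schur_le f C ->
  schur_le (slotker f s) (C ^+ size s).
Proof.
move=> C0 hf; apply: (@schur_prod R (seq L) (slot L D) s (fun p x y => f (p.1 x) (p.2 y)) C) => // p.
exact: schur_pull.
Qed.

Lemma schur_slotker_diff v u (C d : R) (s : seq (slot L D)) : 1 <= C -> 0 <= d ->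
  schur_le v C -> schur_le u C -> schur_le (fun p q => v p q - u p q) d ->
  schur_le (fun x y => slotker v s x y - slotker u s x y) ((size s)%:R * C ^+ size s * d).
Proof.
move=> C1 d0 hv hu hd.
apply: (@schur_prod_diff R (seq L) (slot L D) s (fun p x y => v (p.1 x) (p.2 y))
         (fun p x y => u (p.1 x) (p.2 y)) C d) => // p.
- exact: schur_pull.
- exact: schur_pull.
- exact: (schur_pull p.1 p.2 hd).
Qed.

Lemma schur_expansion u g N : schur_le u 1 -> (forall n, 0 <= g n) ->
  schur_le (wexp u g N) (\sum_(i < N) \sum_(j < N) (2 * g (i + j)%N + 2 * g (i + j).+1)).
Proof.
move=> hu g0; apply: schur_sum => i; apply: schur_sum => j.
have hs s : schur_le (slotker u s) 1.
  by rewrite -(expr1n R (size s)); exact: schur_slotker.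
have h1 := schur_scale (g0 (i + j)%N) (mulr_ge0 (ler0n R 2) ler01) (schur_mul ler01 (schur_apart i j)
  (hs (slots pi e i j))).
have h2 := schur_scale (g0 (i + j).+1) (mulr_ge0 (ler0n R 2) ler01) (schur_mul ler01 (schur_clash i j)
  (hs ((nthR pi e i, nthR pi e j) :: slots pi e i j))).
have := schur_add h1 h2; rewrite !mulr1 => h; apply: schur_mono h.
by rewrite ![2 * _]mulrC.
Qed.

(** The order of quantifiers matters: [B] precedes [v], [u] and [d], so the kernels can be brought
    close enough after [B] is known. *)
Lemma schur_expansion_diff g N (C : R) : 1 <= C -> (forall n, 0 <= g n) ->
  exists2 B : R, 0 <= B & forall v u d, 0 <= d ->
    schur_le v C -> schur_le u C -> schur_le (fun p q => v p q - u p q) d ->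
    schur_le (fun x y => wexp v g N x y - wexp u g N x y) (B * d).
Proof.
move=> C1 g0; have C0 : 0 <= C by lra.
pose b (n : nat) : R := g n * (2 * (n%:R * C ^+ n)).
have b0 n : 0 <= b n by rewrite !mulr_ge0 ?ler0n ?exprn_ge0.
exists (\sum_(i < N) \sum_(j < N) (b (i + j)%N + b (i + j).+1)).
  by apply: sumr_ge0 => i _; apply: sumr_ge0 => j _; exact: addr_ge0.
move=> v u d d0 hv hu hd.
have h : schur_le (fun x y => \sum_(i < N) \sum_(j < N)
   (term pi e side v (fun n => toC (g n)) i j x y - term pi e side u (fun n => toC (g n)) i j x y))
   (\sum_(i < N) \sum_(j < N) (b (i + j)%N * d + b (i + j).+1 * d)).
  apply: schur_sum => i; apply: schur_sum => j.
  have hs s := schur_slotker_diff s C1 d0 hv hu hd.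
  have nn (s : seq (slot L D)) : 0 <= (size s)%:R * C ^+ size s * d.
    by rewrite !mulr_ge0 ?ler0n ?exprn_ge0.
  have nn2 (s : seq (slot L D)) : 0 <= 2 * ((size s)%:R * C ^+ size s * d).
    by rewrite mulr_ge0 ?nn.
  pose s1 : seq (slot L D) := slots pi e i j.
  pose s2 : seq (slot L D) := (nthR pi e i, nthR pi e j) :: s1.
  have h1 := schur_scale (g0 (i + j)%N) (nn2 s1) (schur_mul (nn s1) (schur_apart i j) (hs s1)).
  have h2 := schur_scale (g0 (i + j).+1) (nn2 s2) (schur_mul (nn s2) (schur_clash i j) (hs s2)).
  have := schur_add h1 h2; rewrite /= size_slots -/s1 => {h1 h2} h.
  apply: schur_mono (schur_ext _ h); first by rewrite /b !mulrA.
  by move=> x y; rewrite /term -/s1 -/s2; ring.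
rewrite mulr_suml (eq_bigr (fun i : 'I_N => \sum_(j < N) (b (i + j)%N * d + b (i + j).+1 * d))).
  apply: schur_ext h => x y; rewrite -sumrB; apply: eq_bigr => i _.
  by rewrite -sumrB.
by move=> i _; rewrite mulr_suml; apply: eq_bigr => j _; rewrite mulrDl.
Qed.

(** This separates two roles of the size: the identity with [wker] requires [N] above the lengths of
    the words at hand, while the constant of the difference estimate may depend on the cut-off
    only. *)
Lemma expansion_trunc f g M N x y : (forall n, (M <= n)%N -> g n = 0) -> (M <= N)%N ->
  wexp f g N x y = wexp f g M x y.
Proof.
move=> gM MN; rewrite /expansion.
have z i j : (M <= i)%N || (M <= j)%N -> term pi e side f (fun n => toC (g n)) i j x y = 0.
  move=> h; rewrite /term !gM ?mul0r ?addr0 //; lia.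
rewrite [RHS](big_ord_widen _ (fun i => \sum_(j < M) term pi e side f (fun n => toC (g n)) i j x y)
   MN) [RHS]big_mkcond /=; apply: eq_bigr => i _.
case: ltnP => iM; last by apply: big1 => j _; rewrite z ?iM.
rewrite [RHS](big_ord_widen _ (fun j => term pi e side f (fun n => toC (g n)) i j x y) MN).
rewrite [RHS]big_mkcond /=; apply: eq_bigr => j _; case: ltnP => // jM.
by rewrite z // jM orbT.
Qed.

Lemma geom_le (r : R) n : 0 < r < 1 -> \sum_(i < n) r ^+ i <= (1 - r)^-1.
Proof.
move=> /andP[r0 r1]; have h : 0 < 1 - r by lra.
rewrite -[leRHS]mul1r ler_pdivlMr // mulrC.
have h2 := subrX1 r n.
have -> : (1 - r) * \sum_(i < n) r ^+ i = 1 - r ^+ n by lra.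
have : 0 < r ^+ n by rewrite exprn_gt0.
lra.
Qed.

Lemma geom_tail_le (r : R) m n : 0 < r < 1 ->
  \sum_(i < n) (if (m <= i)%N then r ^+ i else 0) <= r ^+ m * (1 - r)^-1.
Proof.
move=> r01; have /andP[r0 r1] := r01; have [nm|mn] := leqP n m.
  rewrite big1 ?mulr_ge0 ?exprn_ge0 ?invr_ge0 ?subr_ge0 ?(ltW r0) ?(ltW r1) // => i _.
  by rewrite leqNgt (leq_trans (ltn_ord i) nm).
apply: (@le_trans _ _ (r ^+ m * \sum_(i < n - m) r ^+ i)); last first.
  by apply: ler_wpM2l; [exact: exprn_ge0 (ltW r0)|exact: geom_le].
rewrite -(big_mkord xpredT (fun i => if (m <= i)%N then r ^+ i else 0)).
rewrite (big_cat_nat (n := m)) ?(ltnW mn) //= big_nat big1 ?add0r => [|i /andP[_ im]]; last first.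
  by rewrite leqNgt im.
rewrite -{1}[m]add0n big_addn big_mkord mulr_sumr le_eqVlt; apply/orP; left; apply/eqP.
by apply: eq_bigr => i _; rewrite leq_addl exprD mulrC.
Qed.

Definition trunc_weight (r : R) m n : R := if (n < m.*2)%N then r ^+ n else 0.
Definition tail_weight (r : R) m n : R := if (n < m.*2)%N then 0 else r ^+ n.

(** If [i + j] or [i + j + 1] reaches [2 m], then [i] or [j] reaches [m]: a geometric tail times a
    geometric series. The 8 counts two kinds of terms, the bound 2 on indicators, and two choices of
    the large index. *)
Lemma tail_weight_sum (r : R) m N : 0 < r < 1 ->
  \sum_(i < N) \sum_(j < N) (2 * tail_weight r m (i + j)%N + 2 * tail_weight r m (i + j).+1)
    <= 8 * (r ^+ m * (1 - r)^-1 ^+ 2).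
Proof.
move=> r01; have /andP[r0 r1] := r01.
pose t i := if (m <= i)%N then r ^+ i else 0.
have t0 i : 0 <= t i by rewrite /t; case: ifP => // _; rewrite exprn_ge0 // ltW.
have p0 i : 0 <= r ^+ i by rewrite exprn_ge0 // ltW.
have le i j : 2 * tail_weight r m (i + j)%N + 2 * tail_weight r m (i + j).+1
    <= 4 * (t i * r ^+ j + r ^+ i * t j).
  have key : ((m <= i) || (m <= j))%N -> r ^+ (i + j) <= t i * r ^+ j + r ^+ i * t j.
    rewrite exprD /t => /orP[->|->]; rewrite ?lerDl ?lerDr mulr_ge0 //; by case: ifP.
  have nn : 0 <= t i * r ^+ j + r ^+ i * t j by rewrite addr_ge0 // mulr_ge0.
  have h1 : tail_weight r m (i + j)%N <= t i * r ^+ j + r ^+ i * t j.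
    rewrite /tail_weight; case: ltnP => // h; apply: key.
    by have [|] := leqP m i; have [|] := leqP m j => //; lia.
  have h2 : tail_weight r m (i + j).+1 <= t i * r ^+ j + r ^+ i * t j.
    rewrite /tail_weight; case: ltnP => // h; apply: le_trans (key _).
      by rewrite exprS ler_piMl // ltW.
    by have [|] := leqP m i; have [|] := leqP m j => //; lia.
  lra.
apply: (@le_trans _ _ (\sum_(i < N) \sum_(j < N) 4 * (t i * r ^+ j + r ^+ i * t j))).
  by apply: ler_sum => i _; apply: ler_sum => j _; exact: le.
have -> : \sum_(i < N) \sum_(j < N) 4 * (t i * r ^+ j + r ^+ i * t j) =
   8 * ((\sum_(i < N) t i) * (\sum_(j < N) r ^+ j)).
  transitivity (4 * ((\sum_(i < N) t i) * (\sum_(j < N) r ^+ j) +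
                     (\sum_(j < N) r ^+ j) * (\sum_(i < N) t i))); last by ring.
  rewrite !big_distrlr /= -big_split mulr_sumr; apply: eq_bigr => i _ /=.
  by rewrite -big_split mulr_sumr.
rewrite ler_wpM2l // expr2 mulrA ler_pM ?sumr_ge0 //.
  exact: geom_tail_le.
exact: geom_le.
Qed.

(** Each factor off the diagonal yields one [r], and the gap counts these factors, since clashing
    letters share one. For damped kernels [good] means nontrivial, which keeps a letter distinct
    from [e]. *)
Lemma wker_scale (good : pred L) (r : R) u u' x y : u e e = 1 -> u' e e = 1 ->
  (forall l, good l -> u' (pi l) e = toC r * u (pi l) e /\ u' e (pi l) = toC r * u e (pi l)) ->
  (forall a b, side a != side b -> u (pi a) (pi b) = u (pi a) e * u e (pi b)) ->
  (forall a b, side a != side b -> u' (pi a) (pi b) = u' (pi a) e * u' e (pi b)) ->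
  (forall a b, good a -> good b -> a != b -> side a = side b ->
     u' (pi a) (pi b) = toC r * u (pi a) (pi b)) ->
  all good x -> all good y ->
  wker u' x y = toC (r ^+ gap side x y) * wker u x y.
Proof.
move=> ue ue' hl hs hs' hc.
have cM (a b : R) : toC a * toC b = toC (a * b).
  by apply/eqP; rewrite eq_complex /= !mul0r !mulr0 subr0 addr0 !eqxx.
have tl w : all good w -> tailL pi e u' w = toC (r ^+ size w) * tailL pi e u w.
  rewrite /tailL; elim: w => [|a w IH] /=; first by rewrite !big_nil mul1r.
  by move=> /andP[ga gw]; rewrite !big_cons IH // (hl _ ga).1 exprS -cM; ring.
have tr w : all good w -> tailR pi e u' w = toC (r ^+ size w) * tailR pi e u w.
  rewrite /tailR; elim: w => [|a w IH] /=; first by rewrite !big_nil mul1r.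
  by move=> /andP[ga gw]; rewrite !big_cons IH // (hl _ ga).2 exprS -cM; ring.
elim: x y => [|a x IH] y gx gy; first by rewrite !wker0l /= add0n tr.
case: y gy => [|b y] gy; first by rewrite !wker0r [gap _ _ _]addn0 tl.
have /andP[ga gx'] := gx; have /andP[gb gy'] := gy.
rewrite !wker_cons /=; have [_|ab] := eqVneq a b; first exact: IH.
have [sab|sab] := eqVneq (side a) (side b).
  by rewrite hc // tl // tr // exprS exprD -!cM; ring.
rewrite hs' // hs // tl // tr // (hl _ ga).1 (hl _ gb).2.
by rewrite exprD !exprS -!cM; ring.
Qed.

End Estimates.

(** * Normal forms in a free product *)

Section Bijections.
Local Open Scope group_scope.
Variable W : Type.

(** The target group of van der Waerden's argument: by the universal property, the free product acts
    by permutations of words. *)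
Record bij := Bij { bfun :> W -> W; binv : W -> W; bfunK : cancel bfun binv; binvK : cancel binv bfun }.

HB.instance Definition _ := gen_eqMixin bij.
HB.instance Definition _ := gen_choiceMixin bij.

Lemma bij_eq (p q : bij) : bfun p = bfun q -> p = q.
Proof.
case: p q => [f g fg gf] [f' g' fg' gf'] /= ff'; subst f'.
have gg' : g = g' by apply: funext => w; rewrite -{1}(gf' w) fg.
subst g'; congr Bij; exact: Prop_irrelevance.
Qed.

Definition bone : bij := @Bij id id (fun=> erefl) (fun=> erefl).
Definition bopp (p : bij) : bij := Bij (binvK p) (bfunK p).
Definition bmul (p q : bij) : bij :=
  @Bij (p \o q) (binv q \o binv p) (can_comp (bfunK p) (bfunK q)) (can_comp (binvK q) (binvK p)).

Lemma bmulA : associative bmul. Proof. by move=> p q r; apply: bij_eq. Qed.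
Lemma bmul1 : left_id bone bmul. Proof. by move=> p; apply: bij_eq. Qed.
Lemma bmulr1 : right_id bone bmul. Proof. by move=> p; apply: bij_eq. Qed.
Lemma bmulV : left_inverse bone bopp bmul.
Proof. by move=> p; apply: bij_eq; apply: funext => w; exact: bfunK. Qed.
Lemma bmulrV : right_inverse bone bopp bmul.
Proof. by move=> p; apply: bij_eq; apply: funext => w; exact: binvK. Qed.

HB.instance Definition _ := isGroup.Build bij bmulA bmul1 bmulr1 bmulV bmulrV.
End Bijections.

Section SubgroupOf.
Local Open Scope group_scope.
Variables (P : groupType) (Q : P -> Prop).
Hypotheses (Q1 : Q 1) (QM : forall x y, Q x -> Q y -> Q (x * y)) (QV : forall x, Q x -> Q x^-1).

Definition subg_of := {x : P | `[< Q x >]}.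
HB.instance Definition _ := Choice.on subg_of.

Definition sg1 : subg_of := exist _ 1 (introT (asboolP _) Q1).
Definition sgM (x y : subg_of) : subg_of :=
  exist _ (val x * val y) (introT (asboolP _) (QM (elimT (asboolP _) (valP x)) (elimT (asboolP _) (valP y)))).
Definition sgV (x : subg_of) : subg_of :=
  exist _ (val x)^-1 (introT (asboolP _) (QV (elimT (asboolP _) (valP x)))).

Lemma sgMA : associative sgM. Proof. by move=> x y z; apply: val_inj; rewrite /= mulgA. Qed.
Lemma sg1M : left_id sg1 sgM. Proof. by move=> x; apply: val_inj; rewrite /= mul1g. Qed.
Lemma sgM1 : right_id sg1 sgM. Proof. by move=> x; apply: val_inj; rewrite /= mulg1. Qed.
Lemma sgVM : left_inverse sg1 sgV sgM. Proof. by move=> x; apply: val_inj; rewrite /= mulVg. Qed.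
Lemma sgMV : right_inverse sg1 sgV sgM. Proof. by move=> x; apply: val_inj; rewrite /= mulgV. Qed.

HB.instance Definition _ := isGroup.Build subg_of sgMA sg1M sgM1 sgVM sgMV.

(** The universal property maps [P] into the subgroup. Followed by the inclusion, this agrees with
    the identity on both factors, hence everywhere by uniqueness: the factors generate [P]. *)
Lemma free_product_ind (A B : groupType) (iA : A -> P) (iB : B -> P) :
  is_free_product iA iB -> (forall a, Q (iA a)) -> (forall b, Q (iB b)) -> forall x, Q x.
Proof.
move=> [hA hB univ] QA QB x.
pose f a : subg_of := exist _ (iA a) (introT (asboolP _) (QA a)).
pose g b : subg_of := exist _ (iB b) (introT (asboolP _) (QB b)).
have [|| h [hm hf hg _]] := univ subg_of f g.
- by move=> a b; apply: val_inj; exact: hA.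
- by move=> a b; apply: val_inj; exact: hB.
have [k [_ _ _ uniq]] := univ P iA iB hA hB.
have e1 : forall x, val (h x) = k x.
  apply: (uniq (fun x => val (h x))) => [y z|a|b].
  - by rewrite hm.
  - by rewrite hf.
  - by rewrite hg.
have e2 : forall x, x = k x by exact: (uniq id).
rewrite [x]e2 -e1.
by move: (valP (h x)) => /asboolP.
Qed.
End SubgroupOf.

Section NormalForm.
Local Open Scope group_scope.
Variables (A B : groupType).
Local Notation L := (A + B)%type.
Implicit Types (w : seq L) (l : L).

Definition side l : bool := if l is inl _ then true else false.
Definition nontriv l : bool := match l with inl a => a != 1 | inr b => b != 1 end.
Definition linv l : L := match l with inl a => inl a^-1 | inr b => inr b^-1 end.
Definition alternate l l' : bool := side l != side l'.
Definition reduced w : bool := all nontriv w && sorted alternate w.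

Definition consl l w : seq L := if nontriv l then l :: w else w.
Definition actA (a : A) w : seq L :=
  if w is inl a' :: w' then consl (inl (a * a')) w' else consl (inl a) w.
Definition actB (b : B) w : seq L :=
  if w is inr b' :: w' then consl (inr (b * b')) w' else consl (inr b) w.

Lemma reduced_cons l w : reduced (l :: w) =
  [&& nontriv l, (if w is l' :: _ then alternate l l' else true) & reduced w].
Proof.
rewrite /reduced; case: w => [|l' w] /=; rewrite ?andbT // -!andbA; congr (_ && _).
by case: (alternate l l'); rewrite ?andbF.
Qed.

Lemma actA_reduced a w : reduced w -> reduced (actA a w).
Proof.
case: w => [|[a'|b] w] rw; rewrite /actA /consl.
- by case: ifP => // na; rewrite reduced_cons na.
- move: rw; rewrite reduced_cons => /and3P[_ h rw]; case: ifP => // na.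
  by rewrite reduced_cons na rw andbT; case: w h {rw}.
- by case: ifP => // na; rewrite reduced_cons na rw.
Qed.

Lemma actB_reduced b w : reduced w -> reduced (actB b w).
Proof.
case: w => [|[a|b'] w] rw; rewrite /actB /consl.
- by case: ifP => // na; rewrite reduced_cons na.
- by case: ifP => // na; rewrite reduced_cons na rw.
- move: rw; rewrite reduced_cons => /and3P[_ h rw]; case: ifP => // na.
  by rewrite reduced_cons na rw andbT; case: w h {rw}.
Qed.

(** With or without a leading letter of [A], the claim reduces to [key], where a letter is put on a
    word that does not start in [A]. If that letter is trivial, it vanishes and the next
    multiplication creates it anew. *)
Lemma actA_mul a a' w : reduced w -> actA a (actA a' w) = actA (a * a') w.
Proof.
have key c w' : (if w' is l' :: _ then alternate (inl c) l' else true) ->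
    actA a (consl (inl c) w') = consl (inl (a * c)) w'.
  rewrite {1}/consl /=; have [-> h|nc h] := eqVneq c 1.
    by rewrite mulg1; case: w' h => [|[]].
  by [].
case: w => [|[c|b] w] rw; rewrite {2 3}/actA.
- exact: key.
- move: rw; rewrite reduced_cons => /and3P[_ h _]; rewrite key ?mulgA //; by case: w h => [|[]].
- exact: key.
Qed.

Lemma actB_mul b b' w : reduced w -> actB b (actB b' w) = actB (b * b') w.
Proof.
have key c w' : (if w' is l' :: _ then alternate (inr c) l' else true) ->
    actB b (consl (inr c) w') = consl (inr (b * c)) w'.
  rewrite {1}/consl /=; have [-> h|nc h] := eqVneq c 1.
    by rewrite mulg1; case: w' h => [|[]].
  by [].
case: w => [|[a|c] w] rw; rewrite {2 3}/actB.
- exact: key.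
- exact: key.
- move: rw; rewrite reduced_cons => /and3P[_ h _]; rewrite key ?mulgA //; by case: w h => [|[]].
Qed.

Lemma actA1 w : reduced w -> actA 1 w = w.
Proof.
case: w => [|[c|b] w]; rewrite /actA /consl /= ?mul1g ?eqxx //.
by rewrite reduced_cons /= => /andP[->].
Qed.

Lemma actB1 w : reduced w -> actB 1 w = w.
Proof.
case: w => [|[a|c] w]; rewrite /actB /consl /= ?mul1g ?eqxx //.
by rewrite reduced_cons /= => /andP[->].
Qed.

(* The action laws of actA and actB hold on reduced words only. *)
Definition onred (f : seq L -> seq L) w := if reduced w then f w else w.

Lemma onredK (f g : seq L -> seq L) : (forall w, reduced w -> reduced (f w)) ->
  (forall w, reduced w -> g (f w) = w) -> cancel (onred f) (onred g).
Proof. by move=> rf gf w; rewrite /onred; have [rw|/negbTE rw] := boolP (reduced w); rewrite ?rf ?gf ?rw. Qed.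

Lemma actAK a w : reduced w -> actA a^-1 (actA a w) = w.
Proof. by move=> rw; rewrite actA_mul // mulVg actA1. Qed.
Lemma actAVK a w : reduced w -> actA a (actA a^-1 w) = w.
Proof. by move=> rw; rewrite actA_mul // mulgV actA1. Qed.
Lemma actBK a w : reduced w -> actB a^-1 (actB a w) = w.
Proof. by move=> rw; rewrite actB_mul // mulVg actB1. Qed.
Lemma actBVK a w : reduced w -> actB a (actB a^-1 w) = w.
Proof. by move=> rw; rewrite actB_mul // mulgV actB1. Qed.

Definition bijA a : bij (seq L) :=
  Bij (onredK (@actA_reduced a) (@actAK a)) (onredK (@actA_reduced a^-1) (@actAVK a)).
Definition bijB b : bij (seq L) :=
  Bij (onredK (@actB_reduced b) (@actBK b)) (onredK (@actB_reduced b^-1) (@actBVK b)).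

Lemma bijA_hom : group_hom bijA.
Proof.
move=> a a'; apply: bij_eq; apply: funext => w /=; rewrite /onred.
by have [rw|/negbTE rw] := boolP (reduced w); rewrite ?actA_reduced ?rw // actA_mul.
Qed.

Lemma bijB_hom : group_hom bijB.
Proof.
move=> a a'; apply: bij_eq; apply: funext => w /=; rewrite /onred.
by have [rw|/negbTE rw] := boolP (reduced w); rewrite ?actB_reduced ?rw // actB_mul.
Qed.

Variables (P : groupType) (iA : A -> P) (iB : B -> P).

Definition evall l : P := match l with inl a => iA a | inr b => iB b end.
Fixpoint evalw w : P := if w is l :: w' then evall l * evalw w' else 1.

Lemma group_hom1 (G H : groupType) (f : G -> H) : group_hom f -> f 1 = 1.
Proof. by move=> hf; apply: (mulgI (f 1)); rewrite -hf !mulg1. Qed.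

Lemma group_homV (G H : groupType) (f : G -> H) (x : G) : group_hom f -> f x^-1 = (f x)^-1.
Proof.
by move=> hf; apply: (mulgI (f x)); rewrite -hf !mulgV group_hom1.
Qed.

Lemma evalw_cat x y : evalw (x ++ y) = evalw x * evalw y.
Proof. by elim: x => [|l x IH] /=; rewrite ?mul1g // IH mulgA. Qed.

Hypothesis free : is_free_product iA iB.

Lemma evall_linv l : evall (linv l) = (evall l)^-1.
Proof. by case: free => hA hB _; case: l => c /=; rewrite group_homV. Qed.

Lemma evalw_inv w : evalw (rev (map linv w)) = (evalw w)^-1.
Proof.
elim: w => [|l w IH] /=; first by rewrite invg1.
by rewrite rev_cons -cats1 evalw_cat IH /= mulg1 evall_linv invgM.
Qed.

Lemma evalw_consl l w : evalw (consl l w) = evall l * evalw w.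
Proof.
case: free => hA hB _; rewrite /consl.
by case: l => c /=; have [->|nc] := eqVneq c 1; rewrite /= ?group_hom1 ?mul1g.
Qed.

(** The normal form of [x] is the image of the empty word under [x]. By [Q0] the action preserves
    reduced words and commutes with evaluation; adding the same for the inverse gives a subgroup
    that contains both factors. *)
Lemma normal_form_exists : exists nf : P -> seq L,
  [/\ forall x : P, reduced (nf x), forall x : P, evalw (nf x) = x &
      forall w, reduced w -> nf (evalw w) = w].
Proof.
case: (free) => hA hB univ.
have [h [hm hfA hfB _]] := univ _ _ _ bijA_hom bijB_hom.
pose Q0 (x : P) := forall w, reduced w -> reduced (h x w) /\ evalw (h x w) = x * evalw w.
have Q0A a : Q0 (iA a).
  move=> w rw; rewrite hfA /= /onred rw; split; first exact: actA_reduced.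
  by case: w {rw} => [|[c|c] w]; rewrite /actA evalw_consl //= hA mulgA.
have Q0B b : Q0 (iB b).
  move=> w rw; rewrite hfB /= /onred rw; split; first exact: actB_reduced.
  by case: w {rw} => [|[c|c] w]; rewrite /actB evalw_consl //= hB mulgA.
have Q0M (x y : P) : Q0 x -> Q0 y -> Q0 (x * y).
  move=> qx qy w rw; rewrite hm /=; have [r1 e1] := qy w rw.
  by have [r2 e2] := qx _ r1; rewrite e2 e1 mulgA.
have Q01 : Q0 1.
  by move=> w rw; rewrite group_hom1 //= mul1g.
pose Q (x : P) := Q0 x /\ Q0 x^-1.
have Q1 : Q 1 by rewrite /Q invg1.
have QM (x y : P) : Q x -> Q y -> Q (x * y).
  by move=> [x1 x2] [y1 y2]; rewrite /Q invgM; split; apply: Q0M.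
have QV (x : P) : Q x -> Q x^-1 by move=> [x1 x2]; rewrite /Q invgK.
have QA a : Q (iA a) by rewrite /Q -group_homV.
have QB b : Q (iB b) by rewrite /Q -group_homV.
have allQ := free_product_ind Q1 QM QV free QA QB.
exists (fun x => h x [::]); split.
- by move=> x; have [q _] := allQ x; have [] := q [::] isT.
- by move=> x; have [q _] := allQ x; have [_ ->] := q [::] isT; rewrite /= mulg1.
elim=> [|l w IH] /=; first by rewrite group_hom1.
rewrite reduced_cons => /and3P[nl hl rw]; rewrite hm /= IH //.
case: l nl hl => c nc hl /=; rewrite ?hfA ?hfB /= /onred rw.
- by rewrite /actA; case: w hl {IH rw} => [|[a|b] w] //=; rewrite /consl nc.
- by rewrite /actB; case: w hl {IH rw} => [|[a|b] w] //=; rewrite /consl nc.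
Qed.

End NormalForm.

(** * The reduced word of a quotient *)

Section WordDifference.
Variables (A B P : groupType) (iA : A -> P) (iB : B -> P).
Hypothesis free : is_free_product iA iB.
Local Notation L := (A + B)%type.
Implicit Types (x y w : seq L) (l : L).

(** With the other coordinate trivial, one kernel on pairs serves letters of both sides and splits
    between letters of different sides. *)
Definition pairl l : A * B := match l with inl a => (a, monoid.one) | inr b => (monoid.one, b) end.
Definition pair1 : A * B := (monoid.one, monoid.one).

Definition heads_differ x y : bool :=
  match x, y with a :: _, b :: _ => side a != side b | _, _ => true end.

Lemma side_linv l : side (linv l) = side l. Proof. by case: l. Qed.
Lemma nontriv_linv l : nontriv (linv l) = nontriv l.
Proof. by case: l => c /=; rewrite monoid.invg_eq1. Qed.

Lemma reduced_revcat x y : reduced x -> reduced y -> heads_differ x y ->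
  reduced (rev (map (@linv A B) x) ++ y).
Proof.
elim: x y => [|a x IH] y //=; rewrite reduced_cons => /and3P[na ax rx] ry ay.
rewrite rev_cons cat_rcons; apply: IH => //.
  rewrite reduced_cons nontriv_linv na ry andbT /=.
  by case: y {ry} ay => // b y; rewrite /alternate side_linv.
by case: x ax {rx} => // b x; rewrite /alternate /= side_linv eq_sym.
Qed.

Variables (R : realType) (phA : A -> R[i]) (phB : B -> R[i]).
Hypotheses (phA1 : phA monoid.one = 1) (phB1 : phB monoid.one = 1).

Definition letter_wt l : R[i] := match l with inl a => phA a | inr b => phB b end.
Definition pair_ker (p q : A * B) : R[i] :=
  phA (mulg (invg p.1) q.1) * phB (mulg (invg p.2) q.2).

Lemma pair_ker_r l : pair_ker pair1 (pairl l) = letter_wt l.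
Proof.
by case: l => c; rewrite /pair_ker /= !monoid.invg1 !monoid.mul1g ?phA1 ?phB1 ?mulr1 ?mul1r.
Qed.

Lemma pair_ker_l l : pair_ker (pairl l) pair1 = letter_wt (linv l).
Proof.
by case: l => c; rewrite /pair_ker /= !monoid.mulg1 ?monoid.invg1 ?phA1 ?phB1 ?mulr1 ?mul1r.
Qed.

Lemma pair_ker_split a b : side a != side b ->
  pair_ker (pairl a) (pairl b) = pair_ker (pairl a) pair1 * pair_ker pair1 (pairl b).
Proof.
rewrite pair_ker_l pair_ker_r; case: a b => [a|a] [b|b] //= _;
  by rewrite /pair_ker /= ?monoid.invg1 ?monoid.mul1g ?monoid.mulg1 // mulrC.
Qed.

Lemma prod_letter_inv x y :
  \prod_(l <- rev (map (@linv A B) x) ++ y) letter_wt l =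
  tailL pairl pair1 pair_ker x * tailR pairl pair1 pair_ker y.
Proof.
rewrite big_cat; congr (_ * _); last by apply: eq_bigr => l _; rewrite pair_ker_r.
rewrite (perm_big (map (@linv A B) x)) ?perm_rev // big_map.
by apply: eq_bigr => l _; rewrite pair_ker_l.
Qed.

(** The common prefix cancels, leaving the inverse of one tail followed by the other. This is
    reduced if the branching letters lie on different sides; on the same side they merge into [m],
    nontrivial because they differ. *)
Lemma word_difference x y : reduced x -> reduced y ->
  exists z, [/\ reduced z, evalw iA iB z = mulg (invg (evalw iA iB x)) (evalw iA iB y),
    size z = gap (@side A B) x y &
    \prod_(l <- z) letter_wt l = wker pairl pair1 pair_ker x y].
Proof.
have far (x' y' : seq L) : reduced x' -> reduced y' -> heads_differ x' y' ->
  exists z, [/\ reduced z, evalw iA iB z = mulg (invg (evalw iA iB x')) (evalw iA iB y'),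
    size z = (size x' + size y')%N &
    \prod_(l <- z) letter_wt l = tailL pairl pair1 pair_ker x' * tailR pairl pair1 pair_ker y'].
  move=> rx ry h; exists (rev (map (@linv A B) x') ++ y'); split.
  - exact: reduced_revcat.
  - by rewrite evalw_cat evalw_inv.
  - by rewrite size_cat size_rev size_map.
  - exact: prod_letter_inv.
elim: x y => [|a x IH] y rx ry; first exact: (far [::] y).
case: y ry => [|b y] ry.
  have [z [z1 z2 z3 z4]] := far (a :: x) [::] rx ry isT.
  by exists z.
have [ab|ab] := eqVneq a b.
  subst b; move: rx ry; rewrite !reduced_cons => /and3P[_ _ rx] /and3P[_ _ ry].
  have [z [z1 z2 z3 z4]] := IH y rx ry; exists z; split=> //.
  - by rewrite z2 /= monoid.invgM -monoid.mulgA monoid.mulKg.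
  - by rewrite /= eqxx.
  - by rewrite wker_cons eqxx.
have [sab|sab] := eqVneq (side a) (side b); last first.
  have [z [z1 z2 z3 z4]] := far (a :: x) (b :: y) rx ry sab; exists z; split=> //.
    by rewrite z3 /= (negPf ab) (negPf sab).
  rewrite wker_cons (negPf ab) z4 pair_ker_split // /tailL /tailR !big_cons; ring.
pose m : L := match a, b with inl a', inl b' => inl (mulg (invg a') b')
   | inr a', inr b' => inr (mulg (invg a') b') | _, _ => a end.
have [sm nm wm em] : [/\ side m = side b, nontriv m,
    letter_wt m = pair_ker (pairl a) (pairl b) &
    evall iA iB m = mulg (invg (evall iA iB a)) (evall iA iB b)].
  case: free => hA hB _.
  case: a b @m ab sab {rx ry} => [a|a] [b|b] //= ab _.
  - rewrite /pair_ker /= monoid.mulVg phB1 mulr1 hA group_homV //; split=> //.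
    by rewrite monoid.mulg_eq1 eqg_inv; apply: contra ab => /eqP ->.
  - rewrite /pair_ker /= monoid.mulVg phA1 mul1r hB group_homV //; split=> //.
    by rewrite monoid.mulg_eq1 eqg_inv; apply: contra ab => /eqP ->.
move: rx ry; rewrite !reduced_cons => /and3P[_ hx rx] /and3P[_ hy ry].
have rmy : reduced (m :: y).
  rewrite reduced_cons nm ry andbT /=.
  by case: y hy {ry} => // c y; rewrite /alternate sm.
exists (rev (map (@linv A B) x) ++ m :: y); split.
- apply: reduced_revcat => //; case: x hx {rx IH} => // c x.
  by rewrite /alternate /= sm -sab eq_sym.
- rewrite evalw_cat evalw_inv //= em monoid.invgM !monoid.mulgA //.
- by rewrite /= (negPf ab) sab eqxx size_cat size_rev size_map addnS.
- rewrite wker_cons (negPf ab) prod_letter_inv /tailR big_cons pair_ker_r wm.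
  by rewrite -/(tailR _ _ _ _); ring.
Qed.

End WordDifference.

(** * Multipliers of a free product *)

Lemma wker_eq_in (R : realType) (L : eqType) (D : Type) (pi : L -> D) (e : D)
    (S : D -> Prop) (f f' : D -> D -> R[i]) (x y : seq L) :
  (forall p q, S p -> S q -> f p q = f' p q) -> S e ->
  (forall l, l \in x -> S (pi l)) -> (forall l, l \in y -> S (pi l)) ->
  wker pi e f x y = wker pi e f' x y.
Proof.
move=> ff Se.
have tl w : (forall l, l \in w -> S (pi l)) -> tailL pi e f w = tailL pi e f' w.
  by move=> h; apply: eq_big_seq => l lw; apply: ff => //; exact: h.
have tr w : (forall l, l \in w -> S (pi l)) -> tailR pi e f w = tailR pi e f' w.
  by move=> h; apply: eq_big_seq => l lw; apply: ff => //; exact: h.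
elim: x y => [|a x IH] y hx hy; first by rewrite !wker0l tr.
case: y hy => [|b y] hy; first by rewrite !wker0r tl.
have hx' l : l \in x -> S (pi l) by move=> lx; apply: hx; rewrite inE lx orbT.
have hy' l : l \in y -> S (pi l) by move=> lx; apply: hy; rewrite inE lx orbT.
rewrite !wker_cons IH // tl // tr // ff //; first by apply: hx; rewrite mem_head.
by apply: hy; rewrite mem_head.
Qed.

Section PairKernels.
Variables (R : realType) (A B : groupType).
Local Notation CC := R[i].
Local Notation L := (A + B)%type.
Local Notation pairl := (@pairl A B).
Local Notation pair1 := (@pair1 A B).
Implicit Types (fA : A -> A -> CC) (fB : B -> B -> CC).

Definition pairk fA fB (p q : A * B) : CC := fA p.1 q.1 * fB p.2 q.2.

Lemma schur_pairk fA fB (CA CB : R) : 0 <= CB -> schur_le fA CA -> schur_le fB CB ->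
  schur_le (pairk fA fB) (CA * CB).
Proof.
move=> C0 hA hB; apply: schur_mul => //.
  exact: (schur_pull (@fst A B) (@fst A B) hA).
exact: (schur_pull (@snd A B) (@snd A B) hB).
Qed.

Lemma schur_pairk_diff fA fA' fB fB' (C d : R) : 1 <= C -> 0 <= d ->
  schur_le fA C -> schur_le fB' C ->
  schur_le (fun p q => fA p q - fA' p q) d -> schur_le (fun p q => fB p q - fB' p q) d ->
  schur_le (fun p q => pairk fA fB p q - pairk fA' fB' p q) (C * (d + d)).
Proof.
move=> C1 d0 hA hB hA' hB'; apply: schur_mul_diff => //.
- exact: (schur_pull (@fst A B) (@fst A B) hA).
- exact: (schur_pull (@snd A B) (@snd A B) hB).
- exact: (schur_pull (@fst A B) (@fst A B) hA').
- exact: (schur_pull (@snd A B) (@snd A B) hB').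
Qed.

Lemma pairk_diag fA fB p : (forall a, fA a a = 1) -> (forall b, fB b b = 1) ->
  pairk fA fB p p = 1.
Proof. by move=> hA hB; rewrite /pairk hA hB mulr1. Qed.

Lemma pairk_split fA fB (a b : L) : (forall a, fA a a = 1) -> (forall b, fB b b = 1) ->
  side a != side b ->
  pairk fA fB (pairl a) (pairl b) = pairk fA fB (pairl a) pair1 * pairk fA fB pair1 (pairl b).
Proof.
move=> hA hB; rewrite /pairk; case: a b => [a|a] [b|b] //= _; rewrite hA hB; ring.
Qed.

Definition damp (T : eqType) (r : R) (f : T -> T -> CC) (p q : T) : CC :=
  toC r * f p q + toC (1 - r) * (p == q)%:R.

Lemma damp_diag (T : eqType) r (f : T -> T -> CC) p : f p p = 1 -> damp r f p p = 1.
Proof.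
move=> h; rewrite /damp h eqxx !mulr1.
by apply/eqP; rewrite eq_complex /= addr0 !eqxx andbT; apply/eqP; ring.
Qed.

Lemma damp_off (T : eqType) r (f : T -> T -> CC) p q : p != q -> damp r f p q = toC r * f p q.
Proof. by move=> /negPf h; rewrite /damp h mulr0 addr0. Qed.

Lemma schur_damp (T : eqType) r (f : T -> T -> CC) : 0 < r < 1 -> schur_le f 1 ->
  schur_le (damp r f) 1.
Proof.
move=> /andP[r0 r1] hf.
have r2 : 0 <= 1 - r by rewrite subr_ge0 ltW.
have := schur_add (schur_scale (ltW r0) ler01 hf) (schur_scale r2 ler01 (@schur_delta R T)).
by rewrite !mulr1 addrCA subrr addr0.
Qed.

Lemma wker_damp (r : R) fA fB (x y : seq L) :
  (forall a, fA a a = 1) -> (forall b, fB b b = 1) ->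
  all (@nontriv A B) x -> all (@nontriv A B) y ->
  wker pairl pair1 (pairk (damp r fA) (damp r fB)) x y =
  toC (r ^+ gap (@side A B) x y) * wker pairl pair1 (pairk fA fB) x y.
Proof.
move=> hA hB gx gy.
have dA a : damp r fA a a = 1 by exact: damp_diag.
have dB a : damp r fB a a = 1 by exact: damp_diag.
apply: (@wker_scale R L _ _ _ (@side A B) (@nontriv A B)) => //.
- exact: pairk_diag.
- exact: pairk_diag.
- case=> c /= nc; have nc' : monoid.one != c by rewrite eq_sym.
    by rewrite /pairk /= dB hB !mulr1 !damp_off.
  by rewrite /pairk /= dA hA !mul1r !damp_off.
- by move=> a b; exact: pairk_split.
- by move=> a b; exact: pairk_split.
- case=> a [b|b] //= _ _ ab _; rewrite /pairk /= ?dA ?dB ?hA ?hB ?mulr1 ?mul1r damp_off //.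
Qed.

End PairKernels.

Section MainEstimate.
Variables (R : realType) (A B P : groupType) (iA : A -> P) (iB : B -> P).
Hypothesis free : is_free_product iA iB.
Local Notation CC := R[i].
Local Notation L := (A + B)%type.
Local Notation pairl := (@pairl A B).
Local Notation pair1 := (@pair1 A B).
Local Notation evalw := (evalw iA iB).
Variable nf : P -> seq L.
Hypotheses (nf_red : forall x : P, reduced (nf x)) (nfK : forall x : P, evalw (nf x) = x)
  (evalK : forall w, reduced w -> nf (evalw w) = w).

Definition free_mult (r : R) m (phA : A -> CC) (phB : B -> CC) (z : P) : CC :=
  toC (trunc_weight r m (size (nf z))) * \prod_(l <- nf z) letter_wt phA phB l.

Lemma free_mult_ker r m phA phB x y : phA monoid.one = 1 -> phB monoid.one = 1 ->
  quot_ker (free_mult r m phA phB) x y =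
  toC (trunc_weight r m (gap (@side A B) (nf x) (nf y))) *
    wker pairl pair1 (pairk (quot_ker phA) (quot_ker phB)) (nf x) (nf y).
Proof.
move=> hA hB.
have [z [zr ze zs zp]] := word_difference free hA hB (nf_red x) (nf_red y).
rewrite !nfK in ze.
by rewrite /quot_ker /free_mult -ze evalK // zs zp.
Qed.

Lemma free_mult_schur (r : R) m : 0 < r < 1 ->
  exists2 K : R, 0 <= K & forall (t : R) phA phB, 0 < t < 1 ->
    phA monoid.one = 1 -> phB monoid.one = 1 ->
    schur_le (quot_ker phA) (1 + t ^+ 3 / 2) -> schur_le (quot_ker phB) (1 + t ^+ 3 / 2) ->
    schur_le (quot_ker (free_mult r m phA phB))
      (1 + 8 * (r ^+ m * (1 - r)^-1 ^+ 2) + K * t).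
Proof.
move=> r01; have /andP[r0 r1] := r01.
have tw0 n : 0 <= trunc_weight r m n.
  by rewrite /trunc_weight; case: ifP => // _; rewrite exprn_ge0 // ltW.
have lw0 n : 0 <= tail_weight r m n.
  by rewrite /tail_weight; case: ifP => // _; rewrite exprn_ge0 // ltW.
(* On pairs the kernels are bounded by [4 = 2 * 2], and their difference by
   [2 * (6 t + 6 t) = 24 t]. *)
have [K0 K00 hK] := @schur_expansion_diff R L _ pairl pair1 (@side A B) (trunc_weight r m) m.*2
   4 (ler1n _ 4) tw0.
exists (24 * K0); first by rewrite mulr_ge0.
move=> t phA phB t01 hA1 hB1 hA hB; have /andP[t0 t1] := t01.
apply: schur_local => s.
pose ws := flatten (map nf s).
(* The identity is included as the coordinate of the base point and of letters from the other
   factor. *)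
pose sA := monoid.one :: [seq (pairl l).1 | l <- ws].
pose sB := monoid.one :: [seq (pairl l).2 | l <- ws].
have dA p : quot_ker phA p p = 1 by rewrite /quot_ker monoid.mulVg.
have dB p : quot_ker phB p p = 1 by rewrite /quot_ker monoid.mulVg.
have [vA [uA [eA [vA1 uA1] hvA huA hdA]]] := schur_near_positive monoid.one sA t01 hA dA.
have [vB [uB [eB [vB1 uB1] hvB huB hdB]]] := schur_near_positive monoid.one sB t01 hB dB.
pose v := pairk vA vB; pose u := pairk uA uB.
pose u' := pairk (damp r uA) (damp r uB).
have hv : schur_le v 4.
  by have := schur_pairk (ler0n _ _) hvA hvB; congr (schur_le _ _); ring.
have hu1 : schur_le u 1 by rewrite -[X in schur_le _ X](mulr1 1); exact: schur_pairk.
have hu : schur_le u 4 by apply: schur_mono hu1; exact: ler1n.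
have hd : schur_le (fun p q => v p q - u p q) (24 * t).
  have t6 : 0 <= 6 * t by rewrite mulr_ge0 // ltW.
  have := schur_pairk_diff (ler1n _ 2) t6 hvA (schur_mono (ler1n _ 2) huB) hdA hdB.
  by congr (schur_le _ _); ring.
have hu' : schur_le (wker pairl pair1 u') 1.
  apply: schur_wker => [p|].
    by apply: pairk_diag => p'; exact: damp_diag.
  rewrite -[X in schur_le _ X](mulr1 1); apply: schur_pairk => //; exact: schur_damp.
(* Above all word lengths in [s], for exact expansions, and above [m.*2], for the truncation. *)
pose N := ((\max_(x <- s) size (nf x)) + m.*2).+1.
pose T (f : A * B -> A * B -> CC) (g : nat -> R) n (x y : seq L) : CC := expansion pairl pair1 (@side A B) f (fun n => toC (g n)) n x y.
have ht : schur_le (T u (tail_weight r m) N) (8 * (r ^+ m * (1 - r)^-1 ^+ 2)).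
  apply: schur_mono (schur_expansion _ _ _ _ hu1 lw0); exact: tail_weight_sum.
have t24 : 0 <= 24 * t by rewrite mulr_ge0 // ltW.
have hdiff := hK v u (24 * t) t24 hv hu hd.
(* On [s] the damped kernel is the full weighted series for [u]. Removing its tail leaves the
   truncated series, which the last bracket exchanges for that of [v]. *)
exists (fun x y => wker pairl pair1 u' (nf x) (nf y) - T u (tail_weight r m) N (nf x) (nf y)
   + (T v (trunc_weight r m) m.*2 (nf x) (nf y) - T u (trunc_weight r m) m.*2 (nf x) (nf y))).
  have h := schur_add (schur_sub hu' ht) hdiff.
  have := schur_pull nf nf h; congr (schur_le _ _); ring.
move=> x y xs ys; rewrite free_mult_ker //.
have sz z : z \in s -> (size (nf z) < N)%N.
  move=> zs; rewrite ltnS; apply: leq_trans (leq_addr _ _).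
  by apply: (@leq_bigmax_seq _ s xpredT (fun z => size (nf z))).
have inA z l : z \in s -> l \in nf z -> (pairl l).1 \in sA /\ (pairl l).2 \in sB.
  move=> zs lz; have lw : l \in ws by apply/flattenP; exists (nf z) => //; apply/mapP; exists z.
  by rewrite !inE !(map_f (fun l => (pairl l).1)) ?(map_f (fun l => (pairl l).2)) ?orbT.
have -> : wker pairl pair1 (pairk (quot_ker phA) (quot_ker phB)) (nf x) (nf y) =
   wker pairl pair1 v (nf x) (nf y).
  apply: (@wker_eq_in _ _ _ _ _ (fun p : A * B => p.1 \in sA /\ p.2 \in sB)).
  - by move=> p q [pA pB] [qA qB]; rewrite /v /pairk eA // eB.
  - by rewrite /= !mem_head.
  - by move=> l; exact: inA.
  - by move=> l; exact: inA.
have nM : (m.*2 <= N)%N by rewrite leqW // leq_addl.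
have z n : (m.*2 <= n)%N -> trunc_weight r m n = 0.
  by rewrite /trunc_weight ltnNge => ->.
rewrite /T -(expansion_trunc _ _ _ v _ _ z nM) -(expansion_trunc _ _ _ u _ _ z nM).
have vs := @pairk_split R A B vA vB _ _ vA1 vB1.
have us := @pairk_split R A B uA uB _ _ uA1 uB1.
rewrite !expansionE ?sz //; try exact: pairk_diag.
have /andP[gx _] := nf_red x; have /andP[gy _] := nf_red y.
rewrite /u' wker_damp // -/u.
set W := wker _ _ u _ _; set V := wker _ _ v _ _; set n := gap _ _ _.
have e : toC (r ^+ n) = toC (trunc_weight r m n) + toC (tail_weight r m n).
  rewrite /trunc_weight /tail_weight; case: ifP => _; apply/eqP; rewrite eq_complex /= ?addr0 ?add0r;
  by rewrite !eqxx.
by rewrite e; ring.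
Qed.

(** Words shorter than [2 m] over a finite alphabet are finite in number, and a letter outside the
    alphabet annuls the product. *)
Lemma free_mult_finite (r : R) m phA phB (sA : seq A) (sB : seq B) :
  (forall a, a \notin sA -> phA a = 0) -> (forall b, b \notin sB -> phB b = 0) ->
  exists S : seq P, uniq S /\ forall z, z \notin S -> free_mult r m phA phB z = 0.
Proof.
move=> hA hB.
pose LS : seq L := [seq inl a | a <- sA] ++ [seq inr b | b <- sB].
pose wd := fix wd n : seq (seq L) :=
  if n is n'.+1 then [seq l :: w | l <- LS, w <- wd n'] else [:: [::]].
have wdP w : all (mem LS) w -> w \in wd (size w).
  elim: w => [|l w IH] //= /andP[lL wL]; apply/allpairsP; exists (l, w); split=> //.
  exact: IH.
exists (undup [seq evalw w | w <- flatten [seq wd n | n <- iota 0 m.*2]]).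
split=> [|z]; first exact: undup_uniq.
rewrite mem_undup => zS; rewrite /free_mult /trunc_weight.
case: ltnP => szm; last by rewrite mul0r.
have : ~~ all (mem LS) (nf z).
  apply: contra zS => /wdP h; apply/mapP; exists (nf z); last by rewrite nfK.
  by apply/flattenP; exists (wd (size (nf z))) => //; apply: map_f; rewrite mem_iota.
case/allPn => l lz /= lL; rewrite (perm_big _ (perm_to_rem lz)) /= big_cons.
suff -> : letter_wt phA phB l = 0 by rewrite mul0r mulr0.
case: l lL {lz} => c; rewrite mem_cat negb_or => /andP[h1 h2] /=.
  by apply: hA; apply: contra h1; exact: map_f.
by apply: hB; apply: contra h2; exact: map_f.
Qed.

End MainEstimate.

(** * Pointwise convergence and the choice of constants *)

Section Continuity.
Variable R : realType.
Local Notation CC := R[i].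

Lemma schur_complex_const (X : Type) (c : CC) (d : R) : 0 < d -> sqmod c <= d ^+ 2 ->
  schur_le (fun _ _ : X => c) d.
Proof.
move=> d0 hc; have s2 : Num.sqrt d ^+ 2 = d by rewrite sqr_sqrtr // ltW.
have h : schur_le (fun x y : X => \sum_(t : unit) (fun _ _ => c) x t * (fun _ _ => 1) y t) d.
  (* Rank one, with [c] on one side and 1 on the other: squared norms at most [d^2] and 1, balanced
     by the square root of [d]. *)
  apply: (@schur_gram _ _ _ _ _ _ (Num.sqrt d)) => [|x|x]; first by rewrite sqrtr_gt0.
    by rewrite /nrm big_const card_unit /= addr0 s2 -expr2.
  by rewrite /nrm (big_pred1 tt) ?s2 ?sqmod1 ?mulr1 // => -[].
by apply: schur_ext h => x y; rewrite big_const card_unit /= addr0 mulr1.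
Qed.

Lemma sqmodD_le (a b : CC) : sqmod (a + b) <= 2 * (sqmod a + sqmod b).
Proof.
case: a => a1 a2; case: b => b1 b2; rewrite /sqmod /=.
have h1 := sqr_ge0 (a1 - b1); have h2 := sqr_ge0 (a2 - b2); nra.
Qed.

Lemma mul_near_one (eps : R) : 0 < eps -> exists2 eta : R, 0 < eta &
  forall x y : CC, sqmod (x - 1) <= eta ^+ 2 -> sqmod (y - 1) <= eta ^+ 2 ->
    sqmod (x * y - 1) <= eps ^+ 2.
Proof.
(* The estimate ends with [10 * eta ^+ 2], and [10 / 16 < 1]; the minimum with 1 controls the
   product of the two errors. *)
move=> e0; exists (Num.min 1 (eps / 4)) => [|x y].
  by rewrite lt_min ltr01 divr_gt0.
set eta := Num.min _ _ => hx hy.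
have eta0 : 0 < eta by rewrite lt_min ltr01 divr_gt0.
have eta1 : eta <= 1 by rewrite ge_min lexx.
have eta2 : eta <= eps / 4 by rewrite ge_min lexx orbT.
have -> : x * y - 1 = (x - 1) * (y - 1) + ((x - 1) + (y - 1)) by ring.
apply: le_trans (sqmodD_le _ _) _; rewrite sqmodM.
have h1 := sqmodD_le (x - 1) (y - 1).
have px := sqmod_ge0 (x - 1); have py := sqmod_ge0 (y - 1).
have h2 : sqmod (x - 1) * sqmod (y - 1) <= eta ^+ 2.
  have : sqmod (y - 1) <= 1 by apply: le_trans hy _; rewrite expr_le1 // ltW.
  by move=> h; apply: le_trans hx; rewrite ler_piMr.
have h3 : eta ^+ 2 <= (eps / 4) ^+ 2 by rewrite lerXn2r ?nnegrE // ltW // divr_gt0.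
have h4 : (eps / 4) ^+ 2 = eps ^+ 2 / 16 by field.
lra.
Qed.

Lemma word_near_one (A B : Type) (w : seq (A + B)) (eps : R) : 0 < eps ->
  exists2 tau : R, 0 < tau & forall (r : R) (wt : A + B -> CC),
    sqmod (toC r - 1) <= tau ^+ 2 ->
    all (fun l => sqmod (wt l - 1) <= tau ^+ 2) w ->
    sqmod (toC (r ^+ size w) * \prod_(l <- w) wt l - 1) <= eps ^+ 2.
Proof.
elim: w eps => [|l w IH] eps e0.
  by exists 1 => // r wt _ _; rewrite big_nil mulr1 subrr sqmod0 sqr_ge0.
have [e1 e10 h1] := mul_near_one e0.
have [e2 e20 h2] := mul_near_one e10.
have [e3 e30 h3] := IH e1 e10.
exists (Num.min e2 e3) => [|r wt hr /= /andP[hl hw]]; first by rewrite lt_min e20.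
have m0 : 0 < Num.min e2 e3 by rewrite lt_min e20.
have m2 : Num.min e2 e3 ^+ 2 <= e2 ^+ 2 by rewrite lerXn2r ?nnegrE ?(ltW m0) ?(ltW e20) // ge_min lexx.
have m3 : Num.min e2 e3 ^+ 2 <= e3 ^+ 2 by rewrite lerXn2r ?nnegrE ?(ltW m0) ?(ltW e30) // ge_min lexx orbT.
have -> : toC (r ^+ (size w).+1) * \prod_(i <- l :: w) wt i =
   (toC r * wt l) * (toC (r ^+ size w) * \prod_(i <- w) wt i).
  rewrite big_cons exprS; have -> : toC (r * r ^+ size w) = toC r * toC (r ^+ size w).
    by apply/eqP; rewrite eq_complex /= !mul0r !mulr0 subr0 addr0 !eqxx.
  by ring.
apply: h1; first by apply: h2; [exact: le_trans hr m2|exact: le_trans hl m2].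
apply: h3; first exact: le_trans hr m3.
by apply: sub_all hw => l' h; exact: le_trans h m3.
Qed.

Lemma pow_small (r kap : R) : 0 < r < 1 -> 0 < kap -> exists m0 : nat,
  forall m, (m0 <= m)%N -> r ^+ m <= kap.
Proof.
move=> /andP[r0 r1] k0.
pose h := r^-1 - 1.
have h0 : 0 < h by rewrite subr_gt0 invf_gt1.
have rh : r * (1 + h) = 1 by rewrite /h; field; exact: lt0r_neq0.
(* Bernoulli's inequality for [r^-1 = 1 + h], multiplied by [r ^+ m]. *)
have key m : r ^+ m * (1 + m%:R * h) <= 1.
  elim: m => [|m IH]; first by rewrite expr0 mul0r addr0 mulr1.
  apply: le_trans IH; rewrite exprSr -mulrA ler_wpM2l ?exprn_ge0 ?(ltW r0) //.
  have -> : r * (1 + m.+1%:R * h) = r * (1 + h) + r * (m%:R * h) by rewrite -natr1; ring.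
  by rewrite rh lerD2l ler_piMl ?(ltW r1) // mulr_ge0 // ltW.
exists (Num.Def.archi_bound (h * kap)^-1); move=> m hm.
have hk : 0 < h * kap by exact: mulr_gt0.
have b : (h * kap)^-1 <= m%:R.
  apply: le_trans (_ : (Num.Def.archi_bound (h * kap)^-1)%:R <= _); last by rewrite ler_nat.
  by apply: ltW; apply: archi_boundP; rewrite invr_ge0 ltW.
have p : 0 < r ^+ m by exact: exprn_gt0.
have b2 : 1 <= m%:R * (h * kap) by rewrite -ler_pdivrMr // mul1r.
have := key m; nra.
Qed.

End Continuity.

(** A multiple of the point mass at the identity corrects the value there to exactly 1, which puts 1
    on the diagonal of the kernel. Half of [d] pays for the norm of the multiplier, half for the
    correction. *)
Lemma approx_identity (A : groupType) (F : seq A) (d : RR) : weakly_amenable_CH1 A -> 0 < d ->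
  exists phi : A -> CC, [/\ finitely_supported phi, phi monoid.one = 1,
    schur_le (quot_ker phi) (1 + d) & forall g, g \in F -> sqmod (phi g - 1) <= d ^+ 2].
Proof.
move=> [I [le [phi [[i00 _] [_ [trans [dir [fs [pw cb]]]]]]]]] d0.
pose e := d / 2.
have e0 : 0 < e by rewrite divr_gt0.
have ed : e + e = d by rewrite /e; field.
have all_s (s : seq A) : exists i, forall j, le i j -> forall g, g \in s ->
    sqmod (phi j g - 1) < e ^+ 2.
  elim: s => [|g s [i hi]]; first by exists i00.
  have [j hj] := pw g e e0; have [k [ik jk]] := dir i j.
  exists k => l kl g'; rewrite inE => /orP[/eqP ->|gs].
    by rewrite -modsq_sqmod; apply: hj; apply: trans jk kl.
  by apply: hi => //; apply: trans ik kl.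
have [i hi] := all_s (monoid.one :: F); have [j hj] := cb e e0; have [k [ik jk]] := dir i j.
have near g : g \in monoid.one :: F -> sqmod (phi k g - 1) <= e ^+ 2.
  by move=> gF; apply: ltW; exact: hi.
have cbk : schur_le (quot_ker (phi k)) (1 + e).
  by apply: schur_of_cb (hj k jk); rewrite addr_ge0 // ltW.
pose c := 1 - phi k monoid.one.
have hc : sqmod c <= e ^+ 2 by rewrite /c -sqmodN opprB near // mem_head.
exists (fun g => phi k g + c * (g == monoid.one)%:R); split.
- have [[s [us hs]] _] := fs k; exists (undup (monoid.one :: s)); split; first exact: undup_uniq.
  move=> g; rewrite mem_undup inE negb_or => /andP[/negPf -> gs].
  by rewrite hs // mulr0 addr0.
- by rewrite eqxx mulr1 /c addrCA subrr addr0.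
- have h := schur_add cbk (schur_mul ler01 (schur_complex_const e0 hc) (@schur_delta _ A)).
  rewrite mulr1 -addrA ed in h.
  apply: schur_ext h => x y; rewrite /quot_ker; congr (_ + _ * _%:R); congr nat_of_bool.
  apply/eqP/eqP => [->|]; first by rewrite monoid.mulVg.
  by move/monoid.mulg1_eq; rewrite monoid.invgK.
- move=> g gF; case: eqP => [->|_].
    by rewrite mulr1 /c addrCA subrr addr0 subrr sqmod0 sqr_ge0.
  rewrite mulr0 addr0; apply: le_trans (near g _) _; first by rewrite inE gF orbT.
  by rewrite lerXn2r ?nnegrE ?(ltW e0) ?(ltW d0) //; lra.
Qed.

Section FreeProduct.
Variables (A B P : groupType) (iA : A -> P) (iB : B -> P).
Hypothesis free : is_free_product iA iB.
Hypotheses (waA : weakly_amenable_CH1 A) (waB : weakly_amenable_CH1 B).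

(** The choices depend on each other in this order: [tau] for closeness to 1 on [F], then [r], [m],
    the constant [K], [t], and finally the quality [d] of the multipliers of the factors. *)
Lemma free_product_approx (F : seq P) (eps : RR) : 0 < eps ->
  exists phi : P -> CC, [/\ finitely_supported phi,
    schur_le (quot_ker phi) (1 + eps) & forall g, g \in F -> sqmod (phi g - 1) <= eps ^+ 2].
Proof.
move=> e0.
have [nf [nf_red nfK evalK]] := normal_form_exists free.
have [tau tau0 htau] : exists2 tau : RR, 0 < tau & forall g, g \in F ->
    forall (r : RR) (wt : A + B -> CC), sqmod (toC r - 1) <= tau ^+ 2 ->
    all (fun l => sqmod (wt l - 1) <= tau ^+ 2) (nf g) ->
    sqmod (toC (r ^+ size (nf g)) * \prod_(l <- nf g) wt l - 1) <= eps ^+ 2.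
  elim: F => [|g s [t1 t10 h1]]; first by exists 1.
  have [t2 t20 h2] := word_near_one (nf g) e0.
  have m0 : 0 < Num.min t1 t2 by rewrite lt_min t10.
  have m1 : Num.min t1 t2 ^+ 2 <= t1 ^+ 2.
    by rewrite lerXn2r ?nnegrE ?(ltW m0) ?(ltW t10) // ge_min lexx.
  have m2 : Num.min t1 t2 ^+ 2 <= t2 ^+ 2.
    by rewrite lerXn2r ?nnegrE ?(ltW m0) ?(ltW t20) // ge_min lexx orbT.
  exists (Num.min t1 t2) => // g'; rewrite inE => /orP[/eqP ->|gs] r wt hr hw.
    apply: h2; first exact: le_trans hr m2.
    by apply: sub_all hw => l h; exact: le_trans h m2.
  apply: (h1 _ gs); first exact: le_trans hr m1.
  by apply: sub_all hw => l h; exact: le_trans h m1.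
pose a := Num.min (2^-1) tau.
have half0 : (0 : RR) < 2^-1 by rewrite invr_gt0.
have half1 : (2^-1 : RR) < 1 by rewrite invf_lt1 // ltr1n.
have a0 : 0 < a by rewrite lt_min half0.
have a1 : a < 1 by rewrite gt_min half1.
have atau : a <= tau by rewrite ge_min lexx orbT.
pose r := 1 - a.
have r01 : 0 < r < 1 by rewrite /r subr_gt0 a1 /= gtrBl.
have r1 : 0 < (1 - r)^-1 ^+ 2 by rewrite exprn_gt0 // invr_gt0 subr_gt0; case/andP: r01.
pose q := 8 * (1 - r)^-1 ^+ 2.
have q0 : 0 < q by rewrite mulr_gt0.
have [m0 hm0] := @pow_small _ r (eps / 2 / q) r01 (divr_gt0 (divr_gt0 e0 (ltr0n _ 2)) q0).
(* Large enough for the tail, and such that [2 m] exceeds all word lengths in [F], where the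
   truncation is then invisible. *)
pose m := (m0 + \max_(g <- F) size (nf g)).+1.
have hm : 8 * (r ^+ m * (1 - r)^-1 ^+ 2) <= eps / 2.
  have : r ^+ m <= eps / 2 / q by apply: hm0; rewrite leqW // leq_addr.
  by rewrite ler_pdivlMr // /q; congr (_ <= _); ring.
have szm g : g \in F -> (size (nf g) < m.*2)%N.
  move=> gF; rewrite -addnn; apply: ltn_addr; rewrite ltnS; apply: leq_trans (leq_addl _ _).
  by apply: (@leq_bigmax_seq _ F xpredT (fun g => size (nf g))).
have [K K0 hK] := @free_mult_schur _ A B P iA iB free nf nf_red nfK evalK r m r01.
pose t := Num.min (2^-1) (eps / (2 * (K + 1))).
have K1 : 0 < 2 * (K + 1) by rewrite mulr_gt0 // ltr_wpDl.
have t0 : 0 < t by rewrite lt_min half0 divr_gt0.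
have t1 : t < 1 by rewrite gt_min half1.
have Kt : K * t <= eps / 2.
  have : t <= eps / (2 * (K + 1)) by rewrite ge_min lexx orbT.
  rewrite ler_pdivlMr // => h; rewrite ler_pdivlMr //.
  apply: le_trans h; rewrite -subr_ge0.
  have -> : t * (2 * (K + 1)) - K * t * 2 = t * 2 by ring.
  by rewrite mulr_ge0 // ltW.
pose d := Num.min (t ^+ 3 / 2) tau.
have t3 : 0 < t ^+ 3 / 2 by rewrite divr_gt0 // exprn_gt0.
have d0 : 0 < d by rewrite lt_min t3.
have dt : 1 + d <= 1 + t ^+ 3 / 2 by rewrite lerD2l ge_min lexx.
have dtau : d ^+ 2 <= tau ^+ 2.
  by rewrite lerXn2r ?nnegrE ?(ltW d0) ?(ltW tau0) // ge_min lexx orbT.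
pose ws := flatten (map nf F).
have [phA [[sA [_ fA]] A1 cA nA]] :=
  approx_identity [seq (pairl l).1 | l <- ws] waA d0.
have [phB [[sB [_ fB]] B1 cB nB]] :=
  approx_identity [seq (pairl l).2 | l <- ws] waB d0.
exists (free_mult nf r m phA phB); split.
- have [S [uS hS]] := free_mult_finite nfK r m fA fB.
  by exists S.
- have := hK t phA phB; rewrite t0 t1 => /(_ isT A1 B1 (schur_mono dt cA) (schur_mono dt cB)).
  apply: schur_mono; rewrite -addrA lerD2l.
  have -> : eps = eps / 2 + eps / 2 by field.
  exact: lerD.
- move=> g gF; rewrite /free_mult /trunc_weight szm //; apply: htau => //.
    have -> : toC r - 1 = toC (- a).
      by apply/eqP; rewrite eq_complex /= oppr0 addr0 eqxx andbT /r; apply/eqP; ring.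
    rewrite sqmod_toC sqrrN.
    by rewrite lerXn2r ?nnegrE ?(ltW a0) ?(ltW tau0).
  apply/allP => l lg; apply: le_trans dtau.
  have lw : l \in ws by apply/flattenP; exists (nf g) => //; exact: map_f.
  case: l lg lw => c lg lw /=.
    by apply: nA; apply/mapP; exists (inl c).
  by apply: nB; apply/mapP; exists (inr c).
Qed.

End FreeProduct.

Theorem mainTheorem3 (A B P : groupType) (iA : A -> P) (iB : B -> P) :
  is_free_product iA iB ->
  weakly_amenable_CH1 A -> weakly_amenable_CH1 B ->
  weakly_amenable_CH1 P.
Proof.
move=> free waA waB.
(* Lists stand for finite subsets of [P], and [n] for the tolerance [1 / (n + 1)]; since [P] may be
   uncountable, the index set is a net rather than a sequence. *)
pose I : Type := (seq P * nat)%type.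
have pos n : (0 : RR) < n.+1%:R^-1 by rewrite invr_gt0 ltr0n.
have /boolp.choice [phi hphi] : forall i : I, exists phi : P -> CC, [/\ finitely_supported phi,
    schur_le (quot_ker phi) (1 + i.2.+1%:R^-1) &
    forall g, g \in i.1 -> sqmod (phi g - 1) <= (i.2.+1%:R^-1) ^+ 2].
  by move=> [F n]; exact: (free_product_approx free waA waB F (pos n)).
have small (eps : RR) : 0 < eps -> exists n : nat, forall k, (n <= k)%N -> k.+1%:R^-1 < eps.
  move=> e0; exists (Num.Def.archi_bound eps^-1) => k nk.
  have h : eps^-1 < k.+1%:R.
    apply: (@lt_le_trans _ _ (Num.Def.archi_bound eps^-1)%:R).
      by apply: archi_boundP; rewrite invr_ge0 ltW.
    by rewrite ler_nat leqW.
  by rewrite -[ltRHS]invrK ltf_pV2 ?posrE ?invr_gt0 ?ltr0n.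
exists I, (fun i j : I => {subset i.1 <= j.1} /\ (i.2 <= j.2)%N), phi.
split; first by exists ([::], 0%N).
split; first by move=> i; split.
split.
  move=> i j k [ij1 ij2] [jk1 jk2]; split; last exact: leq_trans ij2 jk2.
  by move=> g /ij1 /jk1.
split.
  move=> i j; exists (i.1 ++ j.1, maxn i.2 j.2); split; split=> /=.
  - by move=> g gi; rewrite mem_cat gi.
  - exact: leq_maxl.
  - by move=> g gi; rewrite mem_cat gi orbT.
  - exact: leq_maxr.
split.
  move=> i; have [fs sc _] := hphi i; split=> //.
  exists (1 + i.2.+1%:R^-1); apply: cb_of_schur sc.
  by rewrite addr_ge0 // ltW.
split.
  move=> g eps e0; have [n hn] := small eps e0; exists ([:: g], n) => i [/= gi ni].
  have [_ _ near] := hphi i; rewrite modsq_sqmod.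
  apply: le_lt_trans (near g _) _; first by apply: gi; rewrite mem_head.
  by rewrite ltrXn2r // ?nnegrE ?(ltW e0) ?(ltW (pos _)) // hn.
move=> eps e0; have [n hn] := small eps e0; exists ([::], n) => i [_ /= ni].
have [_ sc _] := hphi i; apply: cb_of_schur; first by rewrite addr_ge0 // ltW.
by apply: schur_mono sc; rewrite lerD2l ltW // hn.
Qed.
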